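(* There is an absolute constant $C$ such that the following holds. Let $2\le y\le x$ and let $T_1,\ldots,T_m$ be disjoint nonempty sets of primes contained in $[2,y]$. For each $1\le i\le m$, suppose that either $f_i(n)=\omega(n,T_i)$ and $Z_i\sim \mathrm{Pois}(H(T_i))$, or $f_i(n)=\Omega(n,T_i)$ and $Z_i\sim\mathrm{Pois}(H'(T_i))$, and assume $Z_1,\ldots,Z_m$ are independent. Then, with $n$ uniform on $\{1,\ldots,\lfloor x\rfloor\}$, \[ d_{TV}\big((f_1(n),\ldots,f_m(n)),(Z_1,\ldots,Z_m)\big)\le C\Big(\sum_{j=1}^m \frac{H''(T_j)}{1+H(T_j)} + u^{-u}\Big),\qquad u=\frac{\log x}{\log y}. \] The constant $C$ is independent of $m,x,y,T_1,\ldots,T_m$.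
   Context: $\mathbb P_x$ denotes probability with respect to an integer $n$ drawn uniformly at random from $[1,x]$. For a finite set $T$ of primes, $\omega(n,T)=\#\{p\mid n: p\in T\}$ and $\Omega(n,T)=\sum_{p\in T}v_p(n)$, where $v_p(n)$ is the exponent of $p$ in $n$. Define $H(T)=\sum_{p\in T}1/p$, $H'(T)=\sum_{p\in T}1/(p-1)$, $H''(T)=\sum_{p\in T}1/p^2$. $\mathrm{Pois}(\lambda)$ is a Poisson random variable with parameter $\lambda$. For random variables $X,Y$ on the same discrete space $\Omega$, $d_{TV}(X,Y)=\sup_{A\subset\Omega}|\mathbb P(X\in A)-\mathbb P(Y\in A)|$. *)

(* Defs.v *)
From mathcomp Require Import all_boot all_order all_algebra.
From mathcomp Require Import all_classical all_reals all_analysis.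
Set Implicit Arguments. Unset Strict Implicit. Unset Printing Implicit Defensive.
Import Order.TTheory GRing.Theory Num.Theory.
Local Open Scope ring_scope.
Local Open Scope classical_set_scope.

Section Defs.
Variable R : realType.

(* A finite set of primes is represented by a duplicate-free list of naturals. *)
Definition Hs (T : seq nat) : R := \sum_(p <- T) (p%:R)^-1.
Definition Hs' (T : seq nat) : R := \sum_(p <- T) ((p%:R - 1)^-1).
Definition Hs'' (T : seq nat) : R := \sum_(p <- T) ((p%:R ^+ 2)^-1).

Definition omegaT (n : nat) (T : seq nat) : nat := count (fun p => (p %| n)%N) T.
Definition OmegaT (n : nat) (T : seq nat) : nat := (\sum_(p <- T) logn p n)%N.

Definition Px (x : R) (E : nat -> Prop) : R :=
  (#|[set k : 'I_(Num.truncn x) | `[< E k.+1 >] ]|)%:R / (Num.truncn x)%:R.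

Definition pois_pmf (lam : R) (k : nat) : R :=
  expR (- lam) * lam ^+ k / (k`!)%:R.

(* Law of (Z_1,...,Z_m) with Z_i ~ Pois(lam i) independent: product pmf. *)
Definition pois_vec_prob (m : nat) (lam : 'I_m -> R) (A : set {ffun 'I_m -> nat})
  : \bar R :=
  (\esum_(k in A) (\prod_(i < m) pois_pmf (lam i) (k i))%:E)%E.

Definition dTV_unif_pois (m : nat) (x : R) (f : nat -> {ffun 'I_m -> nat})
  (lam : 'I_m -> R) : \bar R :=
  ereal_sup [set `| ((Px x (fun n => A (f n)))%:E - pois_vec_prob lam A)%E |%E
            | A in [set: set {ffun 'I_m -> nat}] ].
End Defs.

(* Main.v *)
(** Let [S] be the union of the [T i] and [N] the integer part of [x].  Both laws are
    compared with a model in which the exponents of the primes of [S] are independent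
    geometric variables.

    Kubilius model.  A total variation distance is a sum of positive parts, so it
    suffices to bound from below, for every [S]-smooth [a], the number of [n <= N] whose
    [S]-part is [a].  This is done by a combinatorial lower-bound sieve in which a divisor
    is abandoned, at even steps only, when it becomes too large; the admissible size
    increases slightly each time the primes drop to the square root of their size, which
    makes the losses at small primes summable.  The loss of the sieve and the tail of the
    smooth numbers are both estimated by Rankin's trick with one and the same exponent
    [(1 + log u) / log y], so that the sum over [a] costs nothing.  Only Chebyshev's upper
    bound for primes in dyadic intervals is needed, and the saving [e^L / L] against [e^L]
    in the sum over primes is what yields the full [u^-u].  Errors which are negative
    powers of [y] are absorbed by [H''(T_1) / (1 + H(T_1))].

    Poisson approximation.  In the model the coordinates are independent sums of Bernoulli
    or geometric variables, and each is compared with a Poisson variable by the Stein-Chen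
    method, whose factor [min (1, 1 / lambda)] produces the denominators [1 + H(T_j)]. *)

Require Import Defs.
From mathcomp Require Import all_boot all_order all_algebra.
From mathcomp Require Import all_classical all_reals all_analysis.
From mathcomp Require Import ring lra zify.
Set Implicit Arguments. Unset Strict Implicit. Unset Printing Implicit Defensive.
Import Order.TTheory GRing.Theory Num.Theory.
Import numFieldNormedType.Exports.
Local Open Scope ring_scope.

(** * Chebyshev's bound in dyadic intervals *)

(** Sizes are naturals: [bit_size p] replaces log_2 p, and [kap] is the integer part of log_2 y. The
    sieve level depends on [a]: it is what is left of log x after removing the size of [a] and a
    fixed multiple of [kap]. When too little is left, the Rankin weight of [a] already makes the
    pointwise bound trivial, so large [a] need no separate treatment. In L = 1 + log u the summand 1
    is the room for all losses: e^(-L u) = u^(-u) e^(-u), while the other exponents are O(e^L / L),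
    hence below u = e^(L - 1) once u is large. The estimates also require 16 L <= [kap], which may
    fail when u is huge compared with log y; then u is replaced by [kap], and kap^(-kap) is smaller
    than the negative power of y that can be absorbed. No limit is taken in the final bound:
    truncating exponents at [K] and Poisson vectors to a box costs a multiple of an arbitrary
    [eta > 0], and [eta] is finally the sum of the H''(T_j) / (1 + H(T_j)) itself, which is positive
    as soon as there is one set. *)

Lemma prod_primes_dvd (l : seq nat) (m : nat) :
  uniq l -> (forall p, p \in l -> prime p /\ (p %| m)%N) ->
  ((\prod_(p <- l) p)%N %| m)%N.
Proof.
elim: l => [|p l IH]; first by rewrite big_nil dvd1n.
move=> /= /andP[pl ul] H; rewrite big_cons Gauss_dvd.
  have [_ ->] := H p (mem_head _ _).
  by apply: IH => // q ql; apply: H; rewrite inE ql orbT.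
have [pp _] := H p (mem_head _ _).
rewrite coprime_sym (big_morph (fun x => coprime x p) (id1 := true) (op1 := andb)).
- rewrite big_all; apply/allP => q ql /=.
  have [pq _] : prime q /\ (q %| m)%N by apply: H; rewrite inE ql orbT.
  rewrite prime_coprime // dvdn_prime2 //.
  by apply: contra pl => /eqP <-.
- by move=> x y; rewrite coprimeMl.
- by rewrite coprime1n.
Qed.

Lemma central_bin_le (n : nat) : ('C(2 * n, n) <= 2 ^ (2 * n))%N.
Proof.
have -> : (2 ^ (2 * n) = \sum_(i < (2 * n).+1) 'C(2 * n, i))%N.
  rewrite -[2%N]/(1 + 1)%N expnDn; apply: eq_bigr => i _.
  by rewrite !exp1n !muln1.
have h : (n < (2 * n).+1)%N by lia.
by rewrite (bigD1 (Ordinal h)) //= leq_addr.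
Qed.

Lemma prime_dvd_central_bin (n p : nat) :
  prime p -> (n < p <= 2 * n)%N -> (p %| 'C(2 * n, n))%N.
Proof.
move=> pp /andP[np p2n].
have h : (p %| (2 * n)`!)%N by apply: dvdn_fact; rewrite prime_gt0.
move: h; rewrite -(@bin_fact (2 * n) n) ?leq_pmull //.
have -> : (2 * n - n = n)%N by lia.
have pn : ~~ (p %| n`!)%N.
  rewrite fact_prod (big_morph (dvdn p) (id1 := false) (op1 := orb)).
  - rewrite big_has -all_predC; apply/allP => i /=; rewrite mem_index_iota => hi.
    apply/negP => /dvdn_leq; lia.
  - by move=> x y; rewrite Euclid_dvdM.
  - by rewrite dvdn1; apply/negP => /eqP h; rewrite h in pp.
by rewrite !Euclid_dvdM // (negbTE pn) !orbF.
Qed.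

Local Notation lg := (trunc_log 2).

Lemma lg_prime_gt0 p : prime p -> (0 < lg p)%N.
Proof. by move=> /prime_gt1 h; rewrite trunc_log_gt0 /=. Qed.

(** With n = 2^k, these primes lie in (n, 2n], so their product, at least n^(size l), divides the
    central binomial coefficient, which is at most 2^(2n). *)
Lemma dyadic_prime_count (l : seq nat) (k : nat) :
  uniq l -> (forall p, p \in l -> prime p /\ lg p = k) ->
  (k * size l <= 2 ^ k.+1)%N.
Proof.
move=> ul H.
case: k H => [|[|k]] H; first by rewrite mul0n.
(* [k = 1] is separate because 2 is itself a power of two, so that [2 ^ k < p] fails for it. *)
- have : (size l <= size [:: 2; 3])%N.
    apply: uniq_leq_size => // p /H[pp h].
    have := trunc_log_ltn p (isT : 1 < 2)%N; rewrite h.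
    by have := prime_gt1 pp; case: p {H pp h} => [|[|[|[|]]]].
  rewrite /=; lia.
set n := (2 ^ k.+2)%N.
have Hp p : p \in l -> prime p /\ (n < p <= 2 * n)%N.
  move=> pl; have [pp h] := H p pl; split => //.
  have := trunc_log_ltn p (isT : 1 < 2)%N.
  have := trunc_logP (isT : 1 < 2)%N (prime_gt0 pp).
  rewrite h /n => h1 h2; rewrite -expnS (ltnW h2) andbT ltn_neqAle h1 andbT.
  apply/negP => /eqP h3.
  have : (2 %| p)%N by rewrite -h3 expnS dvdn_mulr.
  rewrite dvdn_prime2 // => /eqP h4; move: h3; rewrite -h4 !expnS.
  have : (0 < 2 ^ k)%N by rewrite expn_gt0.
  lia.
have h1 : (n ^ size l <= \prod_(p <- l) p)%N.
  elim: l {ul H} Hp => [|p l IH] Hp; first by rewrite big_nil.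
  rewrite big_cons /= expnS; apply: leq_mul.
    by have [_ /andP[/ltnW]] := Hp p (mem_head _ _).
  by apply: IH => q ql; apply: Hp; rewrite inE ql orbT.
have h2 : (\prod_(p <- l) p <= 'C(2 * n, n))%N.
  apply: dvdn_leq; first by rewrite bin_gt0; lia.
  apply: prod_primes_dvd => // p /Hp [pp hp]; split => //.
  exact: prime_dvd_central_bin.
have := leq_trans h1 (leq_trans h2 (central_bin_le n)).
by rewrite -expnM leq_exp2l // -expnS.
Qed.

Section Dyadic.
Variable R : realFieldType.

Lemma dyadic_prime_sum (l : seq nat) (k : nat) : (0 < k)%N ->
  uniq l -> (forall p, p \in l -> prime p /\ lg p = k) ->
  \sum_(p <- l) (p%:R)^-1 <= 2 / k%:R :> R.
Proof.
move=> k0 ul H.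
have h1 : \sum_(p <- l) (p%:R)^-1 <= \sum_(p <- l) ((2 ^ k)%:R)^-1 :> R.
  rewrite !big_seq; apply: ler_sum => p /H[pp <-].
  rewrite lef_pV2 ?posrE ?ltr0n ?expn_gt0 ?prime_gt0 // ler_nat.
  exact/trunc_logP/prime_gt0.
apply: le_trans h1 _.
rewrite big_const_seq count_predT iter_addr addr0 -[leLHS]mulr_natr.
have := dyadic_prime_count ul H.
rewrite -(ler_nat R) natrM expnS natrM => h.
have hk : 0 < k%:R :> R by rewrite ltr0n.
have h2 : 0 < (2 ^ k)%:R :> R by rewrite ltr0n expn_gt0.
rewrite ler_pdivlMr // -mulrA [leLHS]mulrC ler_pdivrMr // mulrC; exact: h.
Qed.

Lemma sum_by_dyadic (S : seq nat) (kap : nat) (F : nat -> R) :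
  (forall p, p \in S -> prime p /\ (lg p <= kap)%N) ->
  \sum_(p <- S) F p = \sum_(1 <= k < kap.+1) \sum_(p <- S | lg p == k) F p.
Proof.
move=> H; under [RHS]eq_bigr do rewrite big_mkcond.
rewrite exchange_big /= !big_seq; apply: eq_bigr => p /H[pp hp].
rewrite -big_mkcond /= (big_nat_widenl _ 0) // big_mkord.
have hk : (lg p < kap.+1)%N by [].
rewrite (big_pred1 (Ordinal hk)) // => i /=.
rewrite andbC; apply/idP/eqP => [/andP[_ /eqP h]|->]; first exact/val_inj.
by rewrite eqxx lg_prime_gt0.
Qed.

Lemma sum_dyadic_le (S : seq nat) (kap : nat) (G : nat -> R) :
  uniq S -> (forall p, p \in S -> prime p /\ (lg p <= kap)%N) ->
  (forall k, 0 <= G k) ->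
  \sum_(p <- S) G (lg p) / p%:R <= \sum_(1 <= k < kap.+1) G k * (2 / k%:R).
Proof.
move=> uS H G0; rewrite (sum_by_dyadic _ H) big_nat [leRHS]big_nat.
apply: ler_sum => k /andP[k0 kk].
have -> : \sum_(p <- S | lg p == k) G (lg p) / p%:R =
  G k * \sum_(p <- [seq p <- S | lg p == k]) (p%:R)^-1.
  by rewrite mulr_sumr big_filter; apply: eq_bigr => p /eqP ->.
apply: ler_wpM2l => //; apply: dyadic_prime_sum; rewrite ?filter_uniq //.
by move=> p; rewrite mem_filter => /andP[/eqP h /H[]].
Qed.

(* Block [j] consists of the primes between about [2 ^ (kap / 2 ^ j.+1)] and
   [2 ^ (kap / 2 ^ j)]. *)
Definition blk (kap q : nat) : nat := lg (kap %/ lg q).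

Lemma blk_bounds kap q : prime q -> (lg q <= kap)%N ->
  (lg q * 2 ^ blk kap q <= kap < lg q * 2 ^ (blk kap q).+1)%N.
Proof.
move=> pq h; have q0 := lg_prime_gt0 pq.
have h1 : (0 < kap %/ lg q)%N by rewrite divn_gt0.
have /andP[h2 h3] := trunc_log_bounds (isT : 1 < 2)%N h1.
by rewrite mulnC -leq_divRL // h2 /= mulnC -ltn_divLR.
Qed.

Lemma blk_le kap p q : prime q -> (q <= p)%N -> (blk kap p <= blk kap q)%N.
Proof.
move=> pq qp; apply: leq_trunc_log; apply: leq_div2l; first exact: lg_prime_gt0.
exact: leq_trunc_log.
Qed.

(** The block meets only dyadic levels k with K/2 < k <= K; each contributes at most 2/k <= 4/K, and
    there are at most K of them. *)
Lemma blk_sum_le (S : seq nat) (kap j : nat) :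
  uniq S -> (forall p, p \in S -> prime p /\ (lg p <= kap)%N) ->
  \sum_(p <- S | blk kap p == j) (p%:R)^-1 <= 4 :> R.
Proof.
move=> uS H; set K := (kap %/ 2 ^ j)%N.
pose G (k : nat) : R := ((k <= K) && (K < 2 * k))%N%:R.
have h1 : \sum_(p <- S | blk kap p == j) (p%:R)^-1 <= \sum_(p <- S) G (lg p) / p%:R.
  rewrite [leLHS]big_mkcond !big_seq; apply: ler_sum => p /H[pp hp].
  case: eqP => [hb|_]; last by rewrite mulr_ge0 ?ler0n // invr_ge0.
  suff -> : G (lg p) = 1 by rewrite mul1r.
  have := blk_bounds pp hp; rewrite hb => /andP[h1 h2].
  rewrite /G /K leq_divRL ?expn_gt0 // h1 /= ltn_divLR ?expn_gt0 //.
  by rewrite -mulnA mulnCA -expnS h2.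
apply: le_trans h1 (le_trans (sum_dyadic_le uS H _) _).
  by move=> k; rewrite ler0n.
have [K0|K0] := posnP K.
  rewrite big_nat big1 // => k /andP[k0 _].
  by rewrite /G K0 leqn0 eqn0Ngt k0 mul0r.
have K0' : 0 < K%:R :> R by rewrite ltr0n.
have h2 : \sum_(1 <= k < kap.+1) G k * (2 / k%:R) <=
          \sum_(1 <= k < kap.+1 | (k <= K)%N) 4 / K%:R.
  rewrite big_nat [leRHS]big_nat_cond [leRHS]big_mkcondr /=.
  apply: ler_sum => k /andP[k0 _].
  rewrite /G; case: (leqP k K) => kK /=; last by rewrite mul0r.
  have k0' : 0 < k%:R :> R by rewrite ltr0n.
  case: (ltnP K) => hK; last by rewrite mul0r divr_ge0 // ler0n.
  rewrite mul1r ler_pdivrMr // mulrAC ler_pdivlMr //.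
  have : (K <= 2 * k)%N by apply: ltnW.
  rewrite -(ler_nat R) natrM; lra.
apply: le_trans h2 _; rewrite big_const_seq iter_addr addr0 -[leLHS]mulr_natr.
rewrite mulrAC ler_pdivrMr // ler_wpM2l // ler_nat.
rewrite -size_filter -[leqRHS](size_iota 1 K); apply: uniq_leq_size.
  by rewrite filter_uniq // iota_uniq.
by move=> k; rewrite mem_filter mem_index_iota mem_iota /=; lia.
Qed.

End Dyadic.

(** * The lower-bound sieve *)

Section Sieve.
Variable R : realFieldType.
Variables (ok : nat -> nat -> bool) (bit_size : nat -> nat).

(* The flag [b] says that [d] has an odd number of prime factors and [t] is the total bit
   size of these.  Terms are dropped at odd [d] only, which makes [sieve_sum f false] a
   lower bound and [sieve_sum f true] an upper bound for the sifted count when [f d] counts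
   the multiples of [d].  The list of primes is meant to be decreasing. *)
Fixpoint sieve_sum (f : nat -> R) (b : bool) (d t : nat) (l : seq nat) {struct l} : R :=
  if l is q :: qs then
    sieve_sum f b d t qs
    - (if b && ~~ ok t q then 0 else sieve_sum f (~~ b) (d * q)%N (t + bit_size q)%N qs)
  else f d.

Definition euler_prod (l : seq nat) : R := \prod_(q <- l) (1 - (q%:R)^-1).

(* What the dropped terms contribute when [f d] is proportional to [1 / d], weighted by
   [w] of the prime at which they are dropped. *)
Fixpoint sieve_defect (w : nat -> R) (b : bool) (d t : nat) (l : seq nat) {struct l} : R :=
  if l is q :: qs then
    sieve_defect w b d t qs
    + (if b && ~~ ok t q then w q * euler_prod qs / (d * q)%:R
       else sieve_defect w (~~ b) (d * q)%N (t + bit_size q)%N qs)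
  else 0.

(* For [d = 1] and [l] all the primes of [S], this counts the [n <= N] whose [S]-part is
   the [S]-smooth number [a]. *)
Definition sieve_count (N a d : nat) (l : seq nat) : nat :=
  (\sum_(1 <= n < N.+1) ((a * d %| n) && all (fun q => ~~ (a * q %| n)) l))%N.

Lemma dvdn_mul_coprime (a d q n : nat) : (0 < a)%N -> coprime d q ->
  (a * (d * q) %| n)%N = (a * d %| n)%N && (a * q %| n)%N.
Proof.
move=> a0 cdq; case: (boolP (a %| n)%N) => [/dvdnP[m ->]|an].
  by rewrite [(m * a)%N]mulnC !dvdn_pmul2l // Gauss_dvd.
have H k : (a * k %| n)%N = false.
  by apply: contraNF an; apply: dvdn_trans; exact: dvdn_mulr.
by rewrite !H.
Qed.

(** Buchstab's identity, written additively to avoid subtraction in [nat]. *)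
Lemma sieve_count_cons N a d q l : (0 < a)%N -> coprime d q ->
  (sieve_count N a d (q :: l) + sieve_count N a (d * q) l = sieve_count N a d l)%N.
Proof.
move=> a0 cdq; rewrite /sieve_count -big_split /=; apply: eq_bigr => n _.
rewrite dvdn_mul_coprime //.
by do 3 case: (_ %| _)%N => //=; case: all.
Qed.

(** Both bounds go through one induction, since subtracting a branch turns an upper bound at [d * q]
    into a lower bound at [d] and conversely. *)
Lemma sieve_sum_bounds N a l : (0 < a)%N -> uniq l -> (forall q, q \in l -> prime q) ->
  forall d t, (forall q, q \in l -> coprime d q) ->
  sieve_sum (fun d => (N %/ (a * d))%:R) false d t l <= (sieve_count N a d l)%:R
  <= sieve_sum (fun d => (N %/ (a * d))%:R) true d t l.
Proof.
move=> a0; elim: l => [|q l IH] /=.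
  move=> _ _ d t _; rewrite divn_count_dvd /sieve_count.
  by under [X in _ <= X%:R <= _]eq_bigr do rewrite andbT; rewrite lexx.
move=> /andP[ql ul] Hp d t Hc.
have Hp' p : p \in l -> prime p by move=> pl; apply: Hp; rewrite inE pl orbT.
have Hc' p : p \in l -> coprime d p by move=> pl; apply: Hc; rewrite inE pl orbT.
have cdq : coprime d q by apply: Hc; rewrite mem_head.
have Hcq p : p \in l -> coprime (d * q) p.
  have pq : prime q by apply: Hp; rewrite mem_head.
  move=> pl; rewrite coprimeMl Hc' //= prime_coprime // dvdn_prime2 //; last exact: Hp'.
  by apply: contra ql => /eqP ->.
have /andP[h1 h2] := IH ul Hp' d t Hc'.
have /andP[h3 h4] := IH ul Hp' (d * q)%N (t + bit_size q)%N Hcq.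
have := sieve_count_cons N l a0 cdq.
move=> /(congr1 (fun n => n%:R : R)); rewrite natrD => h5.
apply/andP; split; first lra.
case: ifP => _; last lra.
have : 0 <= (sieve_count N a (d * q) l)%:R :> R by rewrite ler0n.
lra.
Qed.

Lemma sieve_sum_main_term (X : R) l : (forall q, q \in l -> (0 < q)%N) ->
  forall b d t, (0 < d)%N ->
  sieve_sum (fun d => X / d%:R) b d t l =
  X * (euler_prod l / d%:R + (if b then 1 else -1) * sieve_defect (fun=> 1) b d t l).
Proof.
elim: l => [|q l IH] /= Hl b d t d0; first by rewrite /euler_prod big_nil; case: b; ring.
have Hl' p : p \in l -> (0 < p)%N by move=> pl; apply: Hl; rewrite inE pl orbT.
have q0 : (0 < q)%N by apply: Hl; rewrite mem_head.
have dq0 : (0 < d * q)%N by rewrite muln_gt0 d0.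
rewrite !IH // [in RHS]/euler_prod big_cons -/(euler_prod l) natrM.
have hd : d%:R != 0 :> R by rewrite pnatr_eq0 -lt0n.
have hq : q%:R != 0 :> R by rewrite pnatr_eq0 -lt0n.
case: b => /=; last by field; apply/andP.
by case: ok => /=; field; apply/andP.
Qed.

Lemma sorted_gtn_head q l p : sorted gtn (q :: l) -> p \in l -> (p < q)%N.
Proof.
move=> /= h pl.
have tr : transitive gtn by move=> x y z /= h1 h2; exact: ltn_trans h2 h1.
exact: (allP (order_path_min tr h)).
Qed.

Lemma sorted_gtn_tail q l : sorted gtn (q :: l) -> sorted gtn l.
Proof. exact: path_sorted. Qed.

(** Leaves are not counted: a leaf has d <= 2^t <= B, so its error 1 is at most B/d, and the sum of
    1/d over all products of primes of [l] factors. [bit_size q] occurs twice after [ok] because the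
    next prime, smaller than q, is added without a test. *)
Lemma sieve_sum_stable (f f' : nat -> R) (Inv : nat -> Prop) (B : R) :
  (forall d, (0 < d)%N -> `|f d - f' d| <= 1) ->
  (forall t t', (t' <= t)%N -> Inv t -> Inv t') ->
  (forall p q, (q <= p)%N -> (bit_size q <= bit_size p)%N) ->
  (forall t q, ok t q -> Inv (t + bit_size q + bit_size q)%N) ->
  (forall t, Inv t -> (2 ^ t)%:R <= B) ->
  forall l, sorted gtn l -> (forall q, q \in l -> (0 < q <= 2 ^ bit_size q)%N) ->
  forall b d t, (0 < d <= 2 ^ t)%N -> Inv t ->
  (b = false -> forall q, q \in l -> Inv (t + bit_size q)%N) ->
  `|sieve_sum f b d t l - sieve_sum f' b d t l| <= B / d%:R * \prod_(q <- l) (1 + (q%:R)^-1).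
Proof.
move=> Hf HI Hs Hok HB; elim=> [|q l IH] sl Hl b d t /andP[d0 dt] It Iq /=.
  rewrite big_nil mulr1; apply: le_trans (Hf d d0) _.
  rewrite ler_pdivlMr ?ltr0n // mul1r; apply: le_trans (HB t It).
  by rewrite ler_nat.
have Hl' p : p \in l -> (0 < p <= 2 ^ bit_size p)%N.
  by move=> pl; apply: Hl; rewrite inE pl orbT.
have /andP[q0 q2] : (0 < q <= 2 ^ bit_size q)%N by apply: Hl; rewrite mem_head.
have dq : (0 < d * q <= 2 ^ (t + bit_size q))%N by rewrite muln_gt0 d0 q0 expnD leq_mul.
have sl' := sorted_gtn_tail sl.
have P0 : 0 <= \prod_(q <- l) (1 + (q%:R)^-1) :> R.
  by apply: prodr_ge0 => p _; rewrite addr_ge0 // invr_ge0.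
have B0 : 0 <= B by apply: le_trans (HB t It); rewrite ler0n.
have h1 := IH sl' Hl' b d t.
have {h1} : `|sieve_sum f b d t l - sieve_sum f' b d t l| <= B / d%:R * \prod_(q <- l) (1 + (q%:R)^-1).
  by apply: h1 => //; [rewrite d0|move=> hb p pl; apply: Iq; rewrite // inE pl orbT].
have eqB : B / d%:R * \prod_(q0 <- q :: l) (1 + (q0%:R)^-1) =
  B / d%:R * \prod_(q <- l) (1 + (q%:R)^-1) +
  B / (d * q)%:R * \prod_(q <- l) (1 + (q%:R)^-1).
  rewrite big_cons natrM; field.
  by rewrite !pnatr_eq0 -!lt0n d0 q0.
rewrite eqB.
case: ifP => [_ h1|hb h1].
  rewrite !subr0; apply: le_trans h1 _; rewrite lerDl mulr_ge0 //.
  by rewrite divr_ge0 // ler0n.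
have h2 : `|sieve_sum f (~~ b) (d * q) (t + bit_size q) l - sieve_sum f' (~~ b) (d * q) (t + bit_size q) l|
   <= B / (d * q)%:R * \prod_(q <- l) (1 + (q%:R)^-1).
  apply: IH => //.
    case: b hb Iq {h1} => [/= /negbFE /Hok h _|_ Iq].
      by apply: HI h; rewrite leq_addr.
    by apply: Iq; rewrite ?mem_head.
  case: b hb {h1 Iq} => // /= /negbFE /Hok h _ p pl.
  apply: HI h; rewrite leq_add2l; apply: Hs.
  exact/ltnW/(sorted_gtn_head sl pl).
have -> : sieve_sum f b d t l - sieve_sum f (~~ b) (d * q) (t + bit_size q) l -
  (sieve_sum f' b d t l - sieve_sum f' (~~ b) (d * q) (t + bit_size q) l) =
  (sieve_sum f b d t l - sieve_sum f' b d t l) -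
  (sieve_sum f (~~ b) (d * q) (t + bit_size q) l - sieve_sum f' (~~ b) (d * q) (t + bit_size q) l) by ring.
by apply: le_trans (ler_normB _ _) _; apply: lerD.
Qed.

Lemma sieve_defect_sum (J : nat) (w : nat -> nat -> R) l b d t :
  sieve_defect (fun q => \sum_(j < J) w j q) b d t l = \sum_(j < J) sieve_defect (w j) b d t l.
Proof.
elim: l b d t => [|q l IH] b d t /=; first by rewrite big1.
rewrite big_split /= -IH; congr (_ + _); case: ifP => // _.
by rewrite -mulrA mulr_suml; apply: eq_bigr => j _; rewrite mulrA.
Qed.

Lemma eq_sieve_defect (w w' : nat -> R) l b d t :
  (forall q, q \in l -> w q = w' q) -> sieve_defect w b d t l = sieve_defect w' b d t l.
Proof.
elim: l b d t => [|q l IH] b d t H //=.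
have H' p : p \in l -> w p = w' p by move=> pl; apply: H; rewrite inE pl orbT.
by rewrite !IH // H ?mem_head.
Qed.

Lemma sieve_defect0 (w : nat -> R) l b d t :
  (forall q, q \in l -> w q = 0) -> sieve_defect w b d t l = 0.
Proof.
elim: l b d t => [|q l IH] b d t H //=.
have H' p : p \in l -> w p = 0 by move=> pl; apply: H; rewrite inE pl orbT.
by rewrite !IH // H ?mem_head // !mul0r; case: ifP; rewrite addr0.
Qed.

Section Block.
Variables (bk : nat -> nat) (j : nat) (rho tau : nat -> R) (Vj Kj : R).
Hypothesis rhoD : forall a b, rho (a + b)%N = rho a * rho b.
Hypothesis tauD : forall a b, tau (a + b)%N = tau a * tau b.
Hypothesis rho_gt0 : forall a, 0 < rho a.
Hypothesis tau_gt0 : forall a, 0 < tau a.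
Hypothesis tau0 : tau 0%N = 1.
Hypothesis Kj_ge0 : 0 <= Kj.

Let w q : R := (bk q == j)%:R.

(** Euler factor of the Rankin majorant for terms dropped in block [j]. As primes decrease along the
    list, such a term has no prime from a later block, whence the factor 1. *)
Definition rankin_factor q : R :=
  if (bk q < j)%N then 1 + rho (bit_size q) / q%:R
  else if bk q == j then 1 + rho (bit_size q) * tau (bit_size q) / q%:R else 1.

Lemma rankin_factor_ge1 q : 1 <= rankin_factor q.
Proof.
rewrite /rankin_factor; case: ifP => _; last case: ifP => _ //; rewrite lerDl.
  by rewrite divr_ge0 ?ler0n // ltW.
by rewrite divr_ge0 ?ler0n // mulr_ge0 // ltW.
Qed.

Lemma prod_rankin_ge1 l : 1 <= \prod_(q <- l) rankin_factor q.
Proof.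
elim: l => [|q l IH]; first by rewrite big_nil.
by rewrite big_cons mulr_ege1 ?rankin_factor_ge1.
Qed.

(* Here [t] is the part of the size coming from the blocks before [j] and [t'] the part
   coming from block [j], to which the extra Rankin weight [tau] applies. *)
Lemma sieve_defect_block_le l b d t t' : (0 < d)%N -> sorted gtn l ->
  (forall q, q \in l -> (0 < q)%N /\ (j <= bk q)%N) ->
  (forall p q, p \in l -> q \in l -> (q <= p)%N -> (bk p <= bk q)%N) ->
  (forall l1 q l2, l = l1 ++ q :: l2 -> bk q = j -> euler_prod l2 <= Vj) ->
  (forall t' q, q \in l -> bk q = j -> ~~ ok (t + t') q ->
     Vj <= Kj * rho (t + t' + bit_size q)%N * tau (t' + bit_size q)%N) ->
  sieve_defect w b d (t + t') l <=
  Kj * rho (t + t')%N * tau t' / d%:R * \prod_(q <- l) rankin_factor q.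
Proof.
elim: l b d t' => [|q l IH] b d t' d0 sl Hl Hbk HV Hbad.
  by rewrite /= big_nil mulr1 !mulr_ge0 ?invr_ge0 ?ler0n // ltW.
have [q0 jq] := Hl q (mem_head _ _).
move: jq; rewrite leq_eqVlt => /orP[/eqP jq|jq]; last first.
  rewrite sieve_defect0; last first.
    move=> p; rewrite /w inE => /predU1P[->|pl]; first by rewrite gtn_eqF.
    rewrite gtn_eqF //; apply: leq_trans jq _; apply: Hbk.
    - by rewrite mem_head.
    - by rewrite inE pl orbT.
    - exact/ltnW/(sorted_gtn_head sl pl).
  apply: mulr_ge0; last by apply: le_trans (prod_rankin_ge1 _).
  by rewrite !mulr_ge0 ?invr_ge0 ?ler0n // ltW.
have sl' := sorted_gtn_tail sl.
have inl p : p \in l -> p \in q :: l by rewrite inE orbC => ->.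
have IH' b' d' t'' : (0 < d')%N -> sieve_defect w b' d' (t + t'') l <=
    Kj * rho (t + t'')%N * tau t'' / d'%:R * \prod_(q <- l) rankin_factor q.
  move=> d'0; apply: IH => //.
  - by move=> p /inl /Hl.
  - by move=> p p' /inl h /inl h'; exact: Hbk.
  - by move=> l1 p l2 e; apply: (HV (q :: l1)); rewrite e.
  - by move=> t1 p /inl; exact: Hbad.
have P1 := prod_rankin_ge1 l.
rewrite big_cons {1}/rankin_factor -jq ltnn eqxx /=.
have dq0 : (0 < d * q)%N by rewrite muln_gt0 d0.
pose Z := Kj * rho (t + t' + bit_size q)%N * tau (t' + bit_size q)%N / (d * q)%:R *
          \prod_(q <- l) rankin_factor q.
have eqZ : Kj * rho (t + t')%N * tau t' / d%:R *
    ((1 + rho (bit_size q) * tau (bit_size q) / q%:R) * \prod_(q <- l) rankin_factor q) =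
  Kj * rho (t + t')%N * tau t' / d%:R * \prod_(q <- l) rankin_factor q + Z.
  rewrite /Z (rhoD (t + t')) tauD natrM; field.
  by rewrite !pnatr_eq0 -!lt0n d0 q0.
rewrite eqZ; apply: lerD; first exact: IH'.
case: ifP => [/andP[_ hok]|_]; last by rewrite /Z -addnA; exact: IH'.
rewrite /w -jq eqxx mul1r /Z.
have h1 : euler_prod l <= Vj by apply: (HV [::] q).
have h2 : Vj <= _ := Hbad t' q (mem_head _ _) (esym jq) hok.
apply: le_trans (_ : Kj * rho (t + t' + bit_size q)%N * tau (t' + bit_size q)%N / (d * q)%:R <= _).
  by apply: ler_wpM2r; [rewrite invr_ge0 ler0n|exact: le_trans h1 h2].
by rewrite ler_peMr // !mulr_ge0 ?invr_ge0 ?ler0n // ltW.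
Qed.

(** Nothing is charged before block [j], where only [rho] is carried along; on reaching that block
    the previous lemma takes over with [t' = 0]. [Inv] bounds the size at that moment, which forces
    [t'] to be large when a term is dropped. *)
Lemma sieve_defect_le (Inv : nat -> Prop) :
  (forall t t', (t' <= t)%N -> Inv t -> Inv t') ->
  (forall p q, (q <= p)%N -> (bit_size q <= bit_size p)%N) ->
  (forall t q, ok t q -> (bk q < j)%N -> Inv (t + bit_size q + bit_size q)%N) ->
  forall l, sorted gtn l -> (forall q, q \in l -> (0 < q)%N) ->
  (forall p q, p \in l -> q \in l -> (q <= p)%N -> (bk p <= bk q)%N) ->
  (forall l1 q l2, l = l1 ++ q :: l2 -> bk q = j -> euler_prod l2 <= Vj) ->
  (forall t t' q, Inv t -> q \in l -> bk q = j -> ~~ ok (t + t') q ->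
     Vj <= Kj * rho (t + t' + bit_size q)%N * tau (t' + bit_size q)%N) ->
  forall b d t, (0 < d)%N -> Inv t ->
  (b = false -> (0 < j)%N -> forall q, q \in l -> Inv (t + bit_size q)%N) ->
  sieve_defect w b d t l <= Kj * rho t / d%:R * \prod_(q <- l) rankin_factor q.
Proof.
move=> HI Hs Hok; elim=> [|q l IH] sl Hl Hbk HV Hbad b d t d0 It Iq.
  by rewrite /= big_nil mulr1 !mulr_ge0 ?invr_ge0 ?ler0n // ltW.
have q0 := Hl q (mem_head _ _).
have [jq|jq] := leqP j (bk q).
  have := @sieve_defect_block_le (q :: l) b d t 0 d0 sl; rewrite addn0 tau0 mulr1; apply => //.
  - move=> p pl; split; first exact: Hl.
    apply: leq_trans jq _; apply: Hbk => //; first by rewrite mem_head.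
    by move: pl; rewrite inE => /predU1P[->//|/(sorted_gtn_head sl)/ltnW].
  - by move=> t' p pl; exact: Hbad.
have sl' := sorted_gtn_tail sl.
have inl p : p \in l -> p \in q :: l by rewrite inE orbC => ->.
have IH' b' d' t'' : (0 < d')%N -> Inv t'' ->
    (b' = false -> (0 < j)%N -> forall q, q \in l -> Inv (t'' + bit_size q)%N) ->
    sieve_defect w b' d' t'' l <=
    Kj * rho t'' / d'%:R * \prod_(q <- l) rankin_factor q.
  move=> d'0 It' Iq'; apply: IH => //.
  - by move=> p /inl /Hl.
  - by move=> p p' /inl h /inl h'; exact: Hbk.
  - by move=> l1 p l2 e; apply: (HV (q :: l1)); rewrite e.
  - by move=> t1 t2 p h /inl; exact: Hbad.
have P1 := prod_rankin_ge1 l.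
have dq0 : (0 < d * q)%N by rewrite muln_gt0 d0.
have eqZ : Kj * rho t / d%:R *
    ((1 + rho (bit_size q) / q%:R) * \prod_(q <- l) rankin_factor q) =
  Kj * rho t / d%:R * \prod_(q <- l) rankin_factor q +
  Kj * rho (t + bit_size q)%N / (d * q)%:R * \prod_(q <- l) rankin_factor q.
  rewrite rhoD natrM; field.
  by rewrite !pnatr_eq0 -!lt0n d0 q0.
rewrite /= big_cons {1}/rankin_factor jq eqZ; apply: lerD.
  by apply: IH' => // hb j0 p pl; apply: Iq => //; exact: inl.
case: ifP => [_|hb].
  rewrite /w (ltn_eqF jq) !mul0r; apply: mulr_ge0; last exact: le_trans P1.
  by rewrite !mulr_ge0 ?invr_ge0 ?ler0n // ltW.
apply: IH' => //.
  case: b hb Iq => [/= /negbFE h _|_ Iq]; last first.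
    by apply: Iq; rewrite ?mem_head //; exact: leq_ltn_trans jq.
  by apply: HI (Hok _ _ h jq); rewrite leq_addr.
case: b hb Iq => // /= /negbFE h _ _ _ p pl.
apply: HI (Hok _ _ h jq); rewrite leq_add2l; apply: Hs.
exact/ltnW/(sorted_gtn_head sl pl).
Qed.

End Block.
End Sieve.

(** * Rankin's trick *)

Section RankinBounds.
Variable R : realType.
Implicit Types (s x L : R).

Lemma expR1_le4 : expR 1 <= 4 :> R.
Proof.
have h : 1 / 2 <= expR (- (1 / 2)) :> R by have := expR_ge1Dx (- (1 / 2) : R); lra.
have -> : expR 1 = (expR (- (1 / 2)) ^+ 2)^-1 :> R.
  by rewrite -expRM_natr -expRN; congr expR; lra.
have -> : 4 = ((1 / 2) ^+ 2)^-1 :> R by field.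
rewrite lef_pV2 ?posrE ?exprn_gt0 ?expR_gt0 ?divr_gt0 //.
by rewrite lerXn2r ?nnegrE ?expR_ge0 ?divr_ge0.
Qed.

Lemma expR1_ge2 : 2 <= expR 1 :> R.
Proof. have := expR_ge1Dx (1 : R); lra. Qed.

Lemma expR_ge1_ge0 x : 0 <= x -> 1 <= expR x.
Proof. by move=> x0; have := expR_ge1Dx x; lra. Qed.

Lemma inv1B_le_expR x : 0 <= x <= 1 / 2 -> (1 - x)^-1 <= expR (2 * x).
Proof.
move=> /andP[x0 x1].
have h : (1 - x)^-1 <= 1 + 2 * x.
  rewrite -[leLHS]mul1r ler_pdivrMr; last lra.
  have -> : (1 + 2 * x) * (1 - x) = 1 + x * (1 - 2 * x) by ring.
  rewrite lerDl mulr_ge0 //; lra.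
by apply: le_trans h (expR_ge1Dx _).
Qed.

Lemma expRB1_le x : expR x - 1 <= x * expR x.
Proof.
have := expR_ge1Dx (- x); rewrite expRN => h.
have e0 := expR_gt0 x.
have : (1 - x) * expR x <= 1 by rewrite -[leRHS](mulVf (lt0r_neq0 e0)) ler_wpM2r // ltW.
lra.
Qed.

Lemma geom_expR_le s n : 0 < s ->
  \sum_(1 <= k < n.+1) expR (s * k%:R) <= expR (s * n%:R) * (1 + s^-1).
Proof.
move=> s0; elim: n => [|n IH].
  by rewrite big_geq // mulr_ge0 ?expR_ge0 // addr_ge0 // invr_ge0 ltW.
rewrite big_nat_recr //=; apply: le_trans (lerD IH (lexx _)) _.
have -> : expR (s * n.+1%:R) = expR (s * n%:R) * expR s.
  by rewrite -expRD -natr1; congr expR; ring.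
have h1 := expR_ge1Dx s.
have e0 := expR_gt0 (s * n%:R).
have -> : expR (s * n%:R) * (1 + s^-1) + expR (s * n%:R) * expR s =
  expR (s * n%:R) * ((1 + s) * s^-1 + expR s) by field; rewrite gt_eqF.
rewrite -mulrA ler_wpM2l ?expR_ge0 // mulrDr mulr1 addrC lerD2l.
by rewrite ler_wpM2r // invr_ge0 ltW.
Qed.

Definition bit_size (q : nat) : nat := (lg q).+1.

Lemma bit_size_mono p q : (q <= p)%N -> (bit_size q <= bit_size p)%N.
Proof. by move=> h; rewrite ltnS leq_trunc_log. Qed.

Lemma le_exp2_bit_size q : (q <= 2 ^ bit_size q)%N.
Proof. exact/ltnW/trunc_log_ltn. Qed.

Variables (S : seq nat) (kap : nat).
Hypothesis uS : uniq S.
Hypothesis HS : forall p, p \in S -> prime p /\ (lg p <= kap)%N.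
(** Far from Mertens' log [kap], but it only competes with negative powers of y. *)
Lemma sum_inv_le : \sum_(p <- S) (p%:R)^-1 <= 2 * kap%:R :> R.
Proof.
have := @sum_dyadic_le R S kap (fun=> 1) uS HS (fun=> ler01).
rewrite (eq_bigr (fun p => (p%:R)^-1)); last by move=> p _; rewrite mul1r.
move=> /le_trans; apply; rewrite (eq_bigr (fun k => 2 / k%:R)); last by move=> k _; rewrite mul1r.
apply: le_trans (_ : \sum_(1 <= k < kap.+1) 2 <= _); last first.
  by rewrite big_const_nat subn1 /= iter_addr addr0 mulr_natr.
rewrite big_nat [leRHS]big_nat; apply: ler_sum => k /andP[k1 _].
rewrite ler_pdivrMr ?ltr0n //.
have : 1 <= k%:R :> R by rewrite ler1n.
lra.
Qed.

Lemma inv_prime_le_half p : prime p -> 0 <= (p%:R^-1 : R) <= 1 / 2.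
Proof.
move=> pp; rewrite invr_ge0 ler0n /= div1r lef_pV2 ?posrE ?ltr0n ?prime_gt0 //.
by rewrite ler_nat prime_gt1.
Qed.

Lemma euler_prod_gt0 l : (forall p, p \in l -> prime p) -> 0 < euler_prod R l.
Proof.
move=> H; rewrite /euler_prod big_seq; apply: prodr_gt0 => p /H /inv_prime_le_half; lra.
Qed.

Lemma euler_prod_ge_expR l : (forall p, p \in l -> prime p) ->
  expR (- (2 * \sum_(p <- l) (p%:R)^-1)) <= euler_prod R l.
Proof.
move=> H; rewrite mulr_sumr -sumrN expR_sum /euler_prod !big_seq.
apply: ler_prod => p /H /inv_prime_le_half h; rewrite expR_ge0 /=.
rewrite expRN -[leRHS]invrK lef_pV2 ?posrE ?expR_gt0 ?invr_gt0 //; last lra.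
exact: inv1B_le_expR.
Qed.

Local Notation bl := (blk kap).

Lemma blk_sum_lt_le j : \sum_(p <- S | (bl p < j)%N) (p%:R)^-1 <= 4 * j%:R :> R.
Proof.
elim: j => [|j IH]; first by rewrite mulr0 big1.
rewrite (bigID (fun p => (bl p < j)%N)) /= -[j.+1%:R]natr1 mulrDr mulr1; apply: lerD.
  rewrite (eq_bigl (fun p => (bl p < j)%N)) // => p; lia.
rewrite (eq_bigl (fun p => bl p == j)); last by move=> p; lia.
exact: blk_sum_le.
Qed.

(** The primes outside [l2] are at least q, hence in blocks 0 to j, and their reciprocals sum to at
    most 4 (j + 1). *)
Lemma euler_prod_suffix_le l1 q l2 j : perm_eq S (l1 ++ q :: l2) ->
  sorted gtn (l1 ++ q :: l2) -> bl q = j ->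
  euler_prod R l2 <= euler_prod R S * expR (8 * j.+1%:R).
Proof.
move=> pS sl bq; set l := rcons l1 q.
have el : l1 ++ q :: l2 = l ++ l2 by rewrite cat_rcons.
have inS p : p \in l ++ l2 -> p \in S by rewrite -el (perm_mem pS).
have Hl p : p \in l -> prime p by move=> h; have [] := HS (inS p _); rewrite ?mem_cat ?h.
have Hl2 p : p \in l2 -> prime p.
  by move=> h; have [] := HS (inS p _); rewrite ?mem_cat ?h ?orbT.
have -> : euler_prod R S = euler_prod R l * euler_prod R l2 by rewrite /euler_prod (perm_big _ pS) /= el big_cat.
have V2 := euler_prod_gt0 Hl2.
rewrite mulrAC -{1}[euler_prod R l2]mul1r ler_wpM2r ?(ltW V2) //.
have hsum : \sum_(p <- l) (p%:R)^-1 <= 4 * j.+1%:R :> R.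
  apply: le_trans (blk_sum_lt_le j.+1).
  rewrite (perm_big _ pS) /= el big_cat /= -[leLHS]addr0; apply: lerD; last first.
    by apply: sumr_ge0 => p _; rewrite invr_ge0.
  rewrite [leRHS]big_mkcond /= !big_seq; apply: ler_sum => p pl.
  suff hp : (bl p <= j)%N by rewrite ltnS hp.
  rewrite -bq.
  have pq : prime q by apply: Hl; rewrite mem_rcons mem_head.
  apply: blk_le => //; move: pl; rewrite mem_rcons inE => /predU1P[->//|pl].
  move: sl; rewrite -cat1s catA sorted_pairwise; last first.
    by move=> a b c /= h1 h2; exact: ltn_trans h2 h1.
  rewrite pairwise_cat cats1 pairwise_rcons => /and3P[_ /andP[/allP /(_ p pl) h _] _].
  exact: ltnW.
apply: le_trans (ler_wpM2r _ (euler_prod_ge_expR Hl)); last exact: expR_ge0.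
by rewrite -expRD expR_ge1_ge0 //; move: hsum; lra.
Qed.

Variable L : R.
Hypothesis L1 : 1 <= L.
Hypothesis Lk : 16 * L <= kap%:R.

Variable s : R.
Hypothesis sk : s * kap%:R = L.
Let k0 : 0 < kap%:R :> R. Proof. by move: L1 Lk; lra. Qed.
Let s0 : 0 < s. Proof. by rewrite -(pmulr_lgt0 _ k0) sk; move: L1; lra. Qed.
Let s16 : s <= 1 / 16.
Proof. by rewrite -(ler_pM2r k0) sk; move: Lk; lra. Qed.

(* The primes below [sqrt y] contribute the first term, those above it the second. *)
Definition rankin_bound (L : R) : R := 16 * L * expR (L / 2) + 32 * (expR L / L).

(** For levels k <= kap/2, e^z - 1 <= z e^z cancels the 1/k and leaves O(s e^(L/2)) per level. For k
    > kap/2, 1/k < 2/kap and the geometric series in e^(sk) costs a factor of order 1/s = kap/L,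
    which yields e^L / L. *)
Lemma rankin_sum_le :
  \sum_(p <- S) (expR (s * (bit_size p)%:R) - 1) / p%:R <= rankin_bound L.
Proof.
have e4 := expR1_le4.
pose G (k : nat) := expR (s * k.+1%:R) - 1.
apply: le_trans (sum_dyadic_le (G := G) uS HS _) _.
  by move=> k; rewrite subr_ge0 expR_ge1_ge0 // mulr_ge0 ?ler0n // ltW.
have h k : (1 <= k < kap.+1)%N -> G k * (2 / k%:R) <=
    16 * s * expR (L / 2) + 16 / kap%:R * expR (s * k%:R).
  move=> /andP[k1 kk].
  have kR : 0 < k%:R :> R by rewrite ltr0n.
  have k1R : 1 <= k%:R :> R by rewrite ler1n.
  have es : expR s <= 4 by apply: le_trans e4; rewrite ler_expR; move: s16; lra.
  have eS : expR (s * k.+1%:R) = expR (s * k%:R) * expR s.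
    by rewrite -expRD -natr1; congr expR; ring.
  have e0 := expR_ge0 (s * k%:R).
  have eS4 : expR (s * k.+1%:R) <= 4 * expR (s * k%:R).
    by rewrite eS mulrC ler_wpM2r.
  have [hk|hk] := leqP (2 * k) kap.
    have hG : G k <= 8 * s * k%:R * expR (L / 2).
      apply: le_trans (expRB1_le _) _.
      apply: le_trans (_ : (2 * s * k%:R) * (4 * expR (s * k%:R)) <= _).
        apply: ler_pM; rewrite ?expR_ge0 ?mulr_ge0 ?ler0n ?(ltW s0) //.
        have -> : 2 * s * k%:R = s * (2 * k%:R) by ring.
        by rewrite ler_wpM2l ?(ltW s0) // -natr1; lra.
      have -> : 8 * s * k%:R * expR (L / 2) = 2 * s * k%:R * (4 * expR (L / 2)) by ring.
      rewrite ler_wpM2l ?mulr_ge0 ?ler0n ?(ltW s0) // ler_wpM2l // ler_expR.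
      have hk' : 2 * k%:R <= kap%:R :> R by rewrite -natrM ler_nat.
      by have := ler_wpM2l (ltW s0) hk'; rewrite sk; lra.
    have -> : 16 * s * expR (L / 2) = (8 * s * k%:R * expR (L / 2)) * (2 / k%:R).
      by field; rewrite gt_eqF.
    apply: le_trans (ler_wpM2r _ hG) _; first by rewrite divr_ge0 ?ler0n.
    by rewrite lerDl mulr_ge0 ?divr_ge0 ?ler0n.
  have h2 : 2 / k%:R <= 4 / kap%:R :> R.
    rewrite ler_pdivrMr // mulrAC ler_pdivlMr //.
    have : (kap <= 2 * k)%N by apply: ltnW.
    rewrite -(ler_nat R) natrM; lra.
  have hG : G k <= 4 * expR (s * k%:R) by rewrite /G; lra.
  apply: le_trans (_ : (4 * expR (s * k%:R)) * (4 / kap%:R) <= _).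
    have G0 : 0 <= G k by rewrite subr_ge0 expR_ge1_ge0 // mulr_ge0 ?ler0n // ltW.
    have d0 : 0 <= 2 / k%:R :> R by rewrite divr_ge0 ?ler0n.
    exact: ler_pM.
  have -> : 4 * expR (s * k%:R) * (4 / kap%:R) = 16 / kap%:R * expR (s * k%:R) by ring.
  by rewrite lerDr !mulr_ge0 ?expR_ge0 ?(ltW s0).
rewrite big_nat; apply: le_trans (ler_sum _ h) _.
rewrite -big_nat big_split /= -mulr_sumr /rankin_bound; apply: lerD.
  rewrite big_const_nat subn1 /= iter_addr addr0 -[_ *+ kap]mulr_natr.
  by rewrite -sk le_eqVlt; apply/orP; left; apply/eqP; ring.
have := geom_expR_le kap s0; rewrite sk => h1; rewrite -mulr_sumr.
apply: le_trans (ler_wpM2l _ h1) _; first by rewrite divr_ge0 ?ler0n.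
have hs : 1 + s^-1 <= 2 * kap%:R / L.
  have -> : s^-1 = kap%:R / L.
    by rewrite -sk; field; rewrite !gt_eqF.
  have hL : L != 0 by rewrite gt_eqF //; move: L1; lra.
  rewrite ler_pdivlMr; last by move: L1; lra.
  by rewrite mulrDl mulfVK //; move: L1 Lk; lra.
have -> : 32 * (expR L / L) = 16 / kap%:R * (expR L * (2 * kap%:R / L)).
  by field; rewrite !gt_eqF //; move: L1; lra.
by rewrite ler_wpM2l ?divr_ge0 ?ler0n // ler_wpM2l ?expR_ge0.
Qed.

End RankinBounds.

(** * Choice of the sieve levels and the resulting lower bound *)

Section LowerBoundSieve.
Variable R : realType.

Lemma pow2_expR (t : nat) : (2 ^ t)%:R = expR (ln 2 * t%:R) :> R.
Proof. by rewrite expRM_natr lnK ?posrE // natrX. Qed.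

Lemma divn_approx (N a d : nat) : (0 < a)%N -> (0 < d)%N ->
  `|(N %/ (a * d))%:R - N%:R / a%:R / d%:R| <= 1 :> R.
Proof.
move=> a0 d0; have ad0 : (0 < a * d)%N by rewrite muln_gt0 a0.
have P0 : 0 < (a * d)%:R :> R by rewrite ltr0n.
have -> : N%:R / a%:R / d%:R = N%:R / (a * d)%:R :> R.
  by rewrite natrM invfM mulrA.
have h1 : (N %/ (a * d))%:R <= N%:R / (a * d)%:R :> R.
  by rewrite ler_pdivlMr // -natrM ler_nat leq_trunc_div.
have h2 : N%:R / (a * d)%:R <= (N %/ (a * d))%:R + 1 :> R.
  by rewrite ler_pdivrMr // natr1 -natrM ler_nat ltnW // ltn_ceil.
rewrite ler_norml; apply/andP; split; lra.
Qed.

Lemma half_pow_sum_le (J : nat) : \sum_(j < J) (1 / 2) ^+ j <= 2 - 2 * (1 / 2) ^+ J :> R.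
Proof.
elim: J => [|J IH]; first by rewrite big_ord0 expr0; lra.
rewrite big_ord_recr /= exprS; lra.
Qed.

Variables (S ps : seq nat) (kap : nat).
Hypothesis uS : uniq S.
Hypothesis HS : forall p, p \in S -> prime p /\ (lg p <= kap)%N.
Hypothesis pS : perm_eq S ps.
Hypothesis sps : sorted gtn ps.
Variables (L s D0 : R).
Hypothesis L1 : 1 <= L.
Hypothesis Lk : 16 * L <= kap%:R.
Hypothesis sk : s * kap%:R = L.
Hypothesis D0k : kap.+1%:R <= D0.

Let k0 : 0 < kap%:R :> R. Proof. by move: L1 Lk; lra. Qed.
Let s0 : 0 < s. Proof. by rewrite -(pmulr_lgt0 _ k0) sk; move: L1; lra. Qed.
Let s16 : s <= 1 / 16.
Proof. by rewrite -(ler_pM2r k0) sk; move: Lk; lra. Qed.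

Local Notation bl := (blk kap).

Let inps p : (p \in ps) = (p \in S). Proof. by rewrite (perm_mem pS). Qed.

Lemma bit_size_le_kap p : p \in S -> (bit_size p)%:R <= kap%:R + 1 :> R.
Proof. by move=> /HS[_ h]; rewrite natr1 ler_nat ltnS. Qed.

Lemma bit_size_blk p j : p \in S -> bl p = j -> (bit_size p)%:R <= 2 * kap%:R / 2 ^+ j :> R.
Proof.
move=> /HS[pp h] bp; have /andP[h1 _] := blk_bounds pp h.
rewrite ler_pdivlMr ?exprn_gt0 // -natrX -!natrM ler_nat.
have := lg_prime_gt0 pp; rewrite -bp /bit_size => h2.
have h3 : ((lg p).+1 <= 2 * lg p)%N by rewrite mul2n -addnn -add1n leq_add2r.
apply: leq_trans (_ : 2 * lg p * 2 ^ bl p <= _)%N; first by rewrite leq_mul2r h3 orbT.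
by rewrite -mulnA leq_mul2l.
Qed.

(* Closed form of [D0 + \sum_(1 <= i <= j) 2 * kap / 2 ^ i * (13 * i + 1)]: passing to block
   [i] forces at least [13 * i] primes of that block before a term is dropped. *)
Definition sieve_level (j : nat) : R :=
  D0 + 2 * kap%:R * (27 - (13 * j%:R + 27) / 2 ^+ j).

Lemma sieve_level0 : sieve_level 0 = D0.
Proof. by rewrite /sieve_level expr0 divr1 mulr0 add0r subrr mulr0 addr0. Qed.

Lemma sieve_levelS j : sieve_level j.+1 = sieve_level j + 2 * kap%:R / 2 ^+ j.+1 * (13 * j.+1%:R + 1).
Proof.
rewrite /sieve_level exprS -[j.+1%:R]natr1.
have : 2 ^+ j != 0 :> R by rewrite expf_neq0 // pnatr_eq0.
by move=> h; field.
Qed.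

Lemma sieve_level_le i j : (i <= j)%N -> sieve_level i <= sieve_level j.
Proof.
move=> /subnK <-; elim: (j - i)%N => // k IH; rewrite addSn sieve_levelS.
apply: le_trans IH _; rewrite lerDl; apply: mulr_ge0.
  by rewrite divr_ge0 ?mulr_ge0 ?exprn_ge0.
by rewrite addr_ge0 ?mulr_ge0.
Qed.

(** The increments over all blocks form a convergent series, of total 2 * 27 * [kap]. *)
Lemma sieve_level_max j : sieve_level j <= D0 + 54 * kap%:R.
Proof.
have : 0 <= 2 * kap%:R * ((13 * j%:R + 27) / 2 ^+ j) :> R.
  by rewrite !mulr_ge0 ?invr_ge0 ?exprn_ge0 // addr_ge0 // mulr_ge0.
rewrite /sieve_level; lra.
Qed.

(** The second [bit_size q] reserves room for the next prime, which is added untested. *)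
Definition sieve_ok (t q : nat) : bool := (t + bit_size q + bit_size q)%:R <= sieve_level (bl q).

(** Scaled so that the extra weight of one prime of block [j] is at most e. Block 0 gets none: there
    [rho] can already be of order e^L, and no gain in [j] is needed. *)
Definition tau_exp (j : nat) : R := if j is 0 then 0 else 2 ^+ j / (2 * kap%:R).

Lemma tau_bit_size p j : p \in S -> bl p = j -> tau_exp j * (bit_size p)%:R <= 1.
Proof.
move=> pS' bp; have := bit_size_blk pS' bp; rewrite /tau_exp; case: j {bp} => [|j] h.
  by rewrite mul0r.
rewrite mulrAC ler_pdivrMr ?mulr_gt0 // mul1r mulrC -ler_pdivlMr ?exprn_gt0 //.
Qed.

(** Factorwise 1 + z <= e^z. Earlier blocks exceed the sum of (rho - 1)/q by the sum of 1/q, at most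
    4j. For j > 0 the primes of block [j] satisfy 2 * lg q <= kap, so [rho] is at most 4 e^(L/2) and
    [tau] at most 4; as the reciprocals in the block sum to at most 4, this gives 64 e^(L/2). *)
Lemma rankin_prod_le j :
  \prod_(q <- ps) rankin_factor bit_size bl j (fun t => expR (s * t%:R))
                    (fun t => expR (tau_exp j * t%:R)) q
  <= expR (rankin_bound L + 4 * j%:R + 64 * expR (L / 2)).
Proof.
have e4 := @expR1_le4 R.
have eL1 : 1 <= expR (L / 2) by apply: expR_ge1_ge0; move: L1; lra.
pose g (q : nat) : R := (expR (s * (bit_size q)%:R) - 1) / q%:R
   + (if (bl q < j)%N then (q%:R)^-1 else 0)
   + (if bl q == j then 16 * expR (L / 2) / q%:R else 0).
apply: le_trans (_ : \prod_(q <- S) expR (g q) <= _).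
  rewrite -(perm_big _ pS) /= !big_seq; apply: ler_prod => q qS.
  have [pq lq] := HS qS.
  have q0 : 0 < q%:R :> R by rewrite ltr0n prime_gt0.
  apply/andP; split.
    apply: le_trans (rankin_factor_ge1 _ _ _ _ _ _) => //; move=> t; exact: expR_gt0.
  apply: le_trans (expR_ge1Dx _); rewrite /g /rankin_factor.
  have r1 : 0 <= (expR (s * (bit_size q)%:R) - 1) / q%:R.
    by rewrite divr_ge0 ?ler0n // subr_ge0 expR_ge1_ge0 // mulr_ge0 // ltW.
  case: ltngtP => [h|h|h]; rewrite ?addr0.
  - by rewrite mulrBl mul1r subrK.
  - by rewrite lerDl.
  - rewrite lerD2l -mulrDl ler_wpM2r ?invr_ge0 //.
    have ht := tau_bit_size qS h.
    have et : expR (tau_exp j * (bit_size q)%:R) <= 4.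
      by apply: le_trans e4; rewrite ler_expR.
    have := expR_ge0 (s * (bit_size q)%:R); have := expR_ge0 (tau_exp j * (bit_size q)%:R).
    case: (posnP j) => [j0|j0].
      by rewrite j0 /= mul0r expR0; move: eL1; lra.
    have es : expR (s * (bit_size q)%:R) <= 4 * expR (L / 2).
      apply: le_trans (_ : expR (L / 2 + 1) <= _); last first.
        by rewrite expRD mulrC ler_wpM2r ?expR_ge0.
      rewrite ler_expR.
      have /andP[h1 _] := blk_bounds pq lq.
      have h2 : (2 * lg q <= kap)%N.
        apply: leq_trans h1; rewrite mulnC leq_mul2l h; apply/orP; right.
        by rewrite -[leqLHS]expn1 leq_exp2l.
      move: h2; rewrite -(ler_nat R) natrM /bit_size -[(lg q).+1%:R]natr1 => h2.
      have : s * (2 * (lg q)%:R) <= s * kap%:R by rewrite ler_wpM2l ?(ltW s0).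
      rewrite sk => h3; move: s16; lra.
    have : 1 <= expR (s * (bit_size q)%:R) by apply: expR_ge1_ge0; rewrite mulr_ge0 // ltW.
    move=> e1 e2 e3.
    have : expR (s * (bit_size q)%:R) * expR (tau_exp j * (bit_size q)%:R) <= 4 * expR (L / 2) * 4.
      exact: ler_pM.
    lra.
rewrite -expR_sum ler_expR /g !big_split /=.
have h1 := rankin_sum_le uS HS L1 Lk sk.
have h2 := @blk_sum_lt_le R S kap uS HS j.
have h3 := @blk_sum_le R S kap j uS HS.
rewrite -!big_mkcond /= -mulr_sumr.
have : 16 * expR (L / 2) * \sum_(p <- S | bl p == j) (p%:R)^-1 <=
       16 * expR (L / 2) * 4 by rewrite ler_wpM2l ?mulr_ge0 ?expR_ge0.
lra.
Qed.

Definition sieve_err : R :=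
  expR (- (s * (D0 - kap%:R - 1)) + 8 + rankin_bound L + 64 * expR (L / 2)).

(** Here 13 = 8 + 4 + 1: the Euler product over the remaining primes loses e^(8(j+1)), the earlier
    blocks lose e^(4j), and a gain of e^(13j) leaves the summable factor e^(-j). *)
Lemma sieve_defect_block_bound j :
  sieve_defect sieve_ok bit_size (fun q => (bl q == j)%:R) false 1 0 ps <=
  euler_prod R S * sieve_err * expR (- j%:R).
Proof.
pose rho (t : nat) : R := expR (s * t%:R).
pose tau (t : nat) : R := expR (tau_exp j * t%:R).
pose Vj := euler_prod R S * expR (8 * j.+1%:R).
pose Kj := Vj * expR (- (s * (D0 - kap%:R - 1))) * expR (- (13 * j%:R)).
(* Largest possible size on entering block [j]; block 0 is entered with size 0. *)
pose Dp := if j is j'.+1 then sieve_level j' else 0.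
pose Inv (t : nat) := t%:R <= Dp.
have VS0 : 0 < euler_prod R S by apply: euler_prod_gt0 => p /HS[].
have Vj0 : 0 < Vj by rewrite mulr_gt0 ?expR_gt0.
have Kj0 : 0 <= Kj by rewrite !mulr_ge0 ?expR_ge0 // ltW.
have D0k' := D0k; rewrite -natr1 in D0k'.
have DpD0 : (0 < j)%N -> D0 <= Dp.
  by rewrite /Dp; case: (j) => // j' _; rewrite -sieve_level0 sieve_level_le.
have h : sieve_defect sieve_ok bit_size (fun q => (bl q == j)%:R) false 1 0 ps <=
   Kj * rho 0%N / 1%:R * \prod_(q <- ps) rankin_factor bit_size bl j rho tau q.
  apply: (@sieve_defect_le R sieve_ok bit_size bl j rho tau Vj Kj _ _ _ _ _ _ Inv) => //.
  - by move=> a b; rewrite /rho natrD mulrDr expRD.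
  - by move=> a b; rewrite /tau natrD mulrDr expRD.
  - by move=> a; exact: expR_gt0.
  - by move=> a; exact: expR_gt0.
  - by rewrite /tau mulr0 expR0.
  - by move=> t t' tt; apply: le_trans; rewrite ler_nat.
  - exact: bit_size_mono.
  - rewrite /sieve_ok /Inv /Dp => t q h; case: (j) => // j' hj.
    by apply: le_trans h _; exact: sieve_level_le.
  - by move=> q; rewrite inps => /HS[/prime_gt0].
  - by move=> p q _; rewrite inps => /HS[pq _] pq'; exact: blk_le.
  - by move=> l1 q l2 e bq; apply: (@euler_prod_suffix_le R S kap uS HS l1 q l2 j) => //; rewrite -e.
  - move=> t t' q It; rewrite inps => qS bq; rewrite /sieve_ok -ltNge bq !natrD => hb.
    have hs := bit_size_le_kap qS.
    have D0j : D0 <= sieve_level j by rewrite -sieve_level0 sieve_level_le.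
    have -> : Kj * rho (t + t' + bit_size q)%N * tau (t' + bit_size q)%N =
      Vj * (expR (- (s * (D0 - kap%:R - 1))) * expR (- (13 * j%:R)) *
        rho (t + t' + bit_size q)%N * tau (t' + bit_size q)%N) by rewrite /Kj; ring.
    rewrite ler_peMr ?(ltW Vj0) //.
    rewrite /rho /tau -!expRD expR_ge1_ge0 //.
    have h1 : s * (D0 - kap%:R - 1) <= s * (t + t' + bit_size q)%:R.
      rewrite ler_wpM2l ?(ltW s0) // !natrD; move: hb hs D0j; lra.
    (* The dropped term overshoots the level of block [j] while [t] is within the previous one, so
       [t'] plus two copies of [bit_size q] exceeds the increment. Its [+ 1] pays for one copy, and
       13j times the maximal prime size remains. *)
    have h2 : 13 * j%:R <= tau_exp j * (t' + bit_size q)%:R.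
      move: It hb; rewrite /Inv /Dp; case: (posnP j) => [->|j0]; first by rewrite mul0r mulr0.
      have hz := bit_size_blk qS bq.
      rewrite /tau_exp; case: (j) j0 hz => // j' _ hz It; rewrite sieve_levelS => hb.
      have e : (2 * kap%:R / 2 ^+ j'.+1) * (13 * j'.+1%:R) <= (t' + bit_size q)%:R :> R.
        by rewrite natrD; move: It hb hz; lra.
      have z0 : 0 < 2 ^+ j'.+1 / (2 * kap%:R) :> R by rewrite divr_gt0 ?exprn_gt0 // mulr_gt0.
      rewrite -(ler_pM2l z0) in e; apply: le_trans e.
      rewrite le_eqVlt; apply/orP; left; apply/eqP; field.
      by rewrite (gt_eqF k0) andbT expf_neq0 // pnatr_eq0.
    move: h1 h2; lra.
  - by rewrite /Inv /Dp; case: (posnP j) => [->//|/DpD0]; move: D0k' k0; rewrite /Dp; case: (j) => // j'; lra.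
  - move=> _ /DpD0 h q; rewrite inps /Inv add0n => /bit_size_le_kap; move: D0k'; lra.
apply: le_trans h _; rewrite /rho mulr0 expR0 mulr1 divr1.
apply: le_trans (ler_wpM2l Kj0 (rankin_prod_le j)) _.
rewrite /Kj /Vj /sieve_err -!mulrA -!expRD ler_wpM2l ?(ltW VS0) // ler_expR.
rewrite -[j.+1%:R]natr1; lra.
Qed.

Lemma sieve_defect_bound : sieve_defect sieve_ok bit_size (fun=> 1) false 1 0 ps <= 2 * euler_prod R S * sieve_err.
Proof.
have VS0 : 0 < euler_prod R S by apply: euler_prod_gt0 => p /HS[].
have -> : sieve_defect sieve_ok bit_size (fun=> 1) false 1 0 ps =
   sieve_defect sieve_ok bit_size (fun q => \sum_(j < kap.+1) (bl q == j)%:R) false 1 0 ps :> R.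
  apply: eq_sieve_defect => q; rewrite inps => /HS[pq lq].
  have hb : (bl q < kap.+1)%N.
    have /andP[h _] := blk_bounds pq lq; have q0 := lg_prime_gt0 pq.
    rewrite ltnS; apply: leq_trans (leq_trans h (leqnn _)).
    apply: leq_trans (ltnW (ltn_expl (bl q) (isT : 1 < 2)%N)) _.
    by rewrite leq_pmull.
  rewrite (bigD1 (Ordinal hb)) //= eqxx big1 ?addr0 // => i hi.
  by case: eqP => // e; move: hi; rewrite -val_eqE /= e eqxx.
rewrite (@sieve_defect_sum R sieve_ok bit_size kap.+1 (fun j q => (bl q == j)%:R));
apply: le_trans (_ : \sum_(j < kap.+1) euler_prod R S * sieve_err * expR (- j%:R) <= _).
  by apply: ler_sum => j _; exact: sieve_defect_block_bound.
have e0 : 0 < euler_prod R S * sieve_err by rewrite mulr_gt0 ?expR_gt0.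
have -> : 2 * euler_prod R S * sieve_err = euler_prod R S * sieve_err * 2 by ring.
rewrite -mulr_sumr ler_wpM2l ?(ltW e0) //.
apply: le_trans (_ : \sum_(j < kap.+1) (1 / 2) ^+ j <= _).
  apply: ler_sum => j _; rewrite -mulN1r expRM_natr lerXn2r ?nnegrE ?expR_ge0 ?divr_ge0 //.
  by rewrite expRN div1r lef_pV2 ?posrE ?expR_gt0 // expR1_ge2.
apply: le_trans (half_pow_sum_le _) _; rewrite lerBlDr lerDl.
by rewrite mulr_ge0 // exprn_ge0 // divr_ge0.
Qed.

(** The last term is the rounding error: a surviving d is at most 2^(D0 + 54 kap), and the 1/d sum
    to at most e^(2 kap). [D0] stays free because it will depend on [a]. *)
Lemma sieve_count_lower_bound (N a : nat) : (0 < N)%N -> (0 < a)%N ->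
  euler_prod R S / a%:R - (sieve_count N a 1 ps)%:R / N%:R <=
  2 * (euler_prod R S / a%:R) * sieve_err +
  expR (ln 2 * (D0 + 54 * kap%:R)) * expR (2 * kap%:R) / N%:R.
Proof.
move=> N0 a0.
have N0' : 0 < N%:R :> R by rewrite ltr0n.
have a0' : 0 < a%:R :> R by rewrite ltr0n.
have ups : uniq ps by rewrite -(perm_uniq pS).
have Hps q : q \in ps -> prime q by rewrite inps => /HS[].
have D0k' := D0k; rewrite -natr1 in D0k'.
have /andP[h1 _] := @sieve_sum_bounds R sieve_ok bit_size N a ps a0 ups Hps 1 0 (fun q _ => coprime1n q).
pose f (d : nat) : R := (N %/ (a * d))%:R.
pose f' (d : nat) : R := N%:R / a%:R / d%:R.
have h2 := @sieve_sum_main_term R sieve_ok bit_size (N%:R / a%:R) ps (fun q h => prime_gt0 (Hps q h)) false 1 0 isT.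
have h3 : `|sieve_sum sieve_ok bit_size f false 1 0 ps - sieve_sum sieve_ok bit_size f' false 1 0 ps| <=
   expR (ln 2 * (D0 + 54 * kap%:R)) / 1%:R * \prod_(q <- ps) (1 + (q%:R)^-1).
  pose Inv (t : nat) := t%:R <= D0 + 54 * kap%:R.
  apply: (@sieve_sum_stable R sieve_ok bit_size f f' Inv) => //.
  - by move=> d d0; exact: divn_approx.
  - by move=> t t' tt; apply: le_trans; rewrite ler_nat.
  - exact: bit_size_mono.
  - by move=> t q h; apply: le_trans h (sieve_level_max _).
  - move=> t It; rewrite pow2_expR ler_expR ler_wpM2l //.
    by apply: ln_ge0; lra.
  - by move=> q /Hps /prime_gt0 ->; rewrite le_exp2_bit_size.
  - by rewrite /Inv; move: D0k' k0; lra.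
  - by move=> _ q; rewrite inps /Inv add0n => /bit_size_le_kap; move: D0k' k0; lra.
have h4 : \prod_(q <- ps) (1 + (q%:R)^-1) <= expR (2 * kap%:R) :> R.
  apply: le_trans (_ : expR (\sum_(q <- S) (q%:R)^-1) <= _); last first.
    by rewrite ler_expR sum_inv_le.
  rewrite expR_sum (perm_big _ pS) /=; apply: ler_prod => q _.
  by rewrite addr_ge0 ?invr_ge0 //= expR_ge1Dx.
have h5 : `|sieve_sum sieve_ok bit_size f false 1 0 ps - sieve_sum sieve_ok bit_size f' false 1 0 ps| <=
   expR (ln 2 * (D0 + 54 * kap%:R)) * expR (2 * kap%:R).
  by apply: le_trans h3 _; rewrite divr1 ler_wpM2l ?expR_ge0.
have VpS : euler_prod R ps = euler_prod R S by rewrite /euler_prod (perm_big _ pS).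
move: h5; rewrite ler_norml => /andP[h5 _].
move: h5; rewrite [sieve_sum _ _ f' _ _ _ _]h2 divr1 VpS mulN1r => h5.
rewrite -/f in h1.
have h6 : N%:R / a%:R * (euler_prod R S - sieve_defect sieve_ok bit_size (fun=> 1) false 1 0 ps) -
   expR (ln 2 * (D0 + 54 * kap%:R)) * expR (2 * kap%:R) <= (sieve_count N a 1 ps)%:R.
  by move: h1 h5; lra.
have h7 : N%:R / a%:R * sieve_defect sieve_ok bit_size (fun=> 1) false 1 0 ps <=
          N%:R / a%:R * (2 * euler_prod R S * sieve_err).
  by rewrite ler_wpM2l ?sieve_defect_bound // divr_ge0 ?ler0n.
rewrite -(ler_pM2r N0') mulrBl mulfVK ?gt_eqF // mulrDl [leRHS]addrC mulfVK ?gt_eqF //.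
have e1 : euler_prod R S / a%:R * N%:R = N%:R / a%:R * euler_prod R S by ring.
have e2 : 2 * (euler_prod R S / a%:R) * sieve_err * N%:R = N%:R / a%:R * (2 * euler_prod R S * sieve_err) by ring.
rewrite e1 e2; move: h6 h7; lra.
Qed.

End LowerBoundSieve.

(** * The Kubilius model *)

Section SmoothNumbers.
Variable K : nat.

(* The smooth numbers on [l] with all exponents below [K]; truncating the exponents keeps
   every sum finite. *)
Fixpoint smooth_nums (l : seq nat) : seq nat :=
  if l is p :: l' then [seq (p ^ k * a)%N | k <- iota 0 K, a <- smooth_nums l'] else [:: 1%N].

Lemma big_smooth_nums (V : nmodType) (F : nat -> V) p l :
  \sum_(a <- smooth_nums (p :: l)) F a =
  \sum_(k <- iota 0 K) \sum_(a <- smooth_nums l) F (p ^ k * a)%N.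
Proof. exact: big_allpairs_dep. Qed.

Lemma smooth_nums_gt0 l a : (forall p, p \in l -> prime p) -> a \in smooth_nums l -> (0 < a)%N.
Proof.
elim: l a => [|p l IH] a Hl; first by rewrite mem_seq1 => /eqP ->.
case/allpairsP => -[k b] /= [_ hb ->].
rewrite muln_gt0 expn_gt0 prime_gt0 ?Hl ?mem_head //=.
by apply: IH => // q ql; apply: Hl; rewrite inE ql orbT.
Qed.

Lemma smooth_nums_logn0 l a p : (forall p, p \in l -> prime p) -> prime p -> p \notin l ->
  a \in smooth_nums l -> logn p a = 0%N.
Proof.
elim: l a => [|q l IH] a Hl pp; first by move=> _; rewrite mem_seq1 => /eqP ->; rewrite logn1.
rewrite inE negb_or => /andP[pq pl] /allpairsP[[k b] /= [_ hb ->]].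
have Hl' r : r \in l -> prime r by move=> rl; apply: Hl; rewrite inE rl orbT.
have pq' : prime q by apply: Hl; rewrite mem_head.
rewrite lognM ?expn_gt0 ?(prime_gt0 pq') ?(smooth_nums_gt0 Hl' hb) // (IH b) // addn0 lognX.
by rewrite logn_prime // (negbTE pq) muln0.
Qed.

Lemma logn_smooth_head l b p k : (forall p, p \in l -> prime p) -> prime p -> p \notin l ->
  b \in smooth_nums l -> logn p (p ^ k * b) = k.
Proof.
move=> Hl pp pl hb.
rewrite lognM ?expn_gt0 ?(prime_gt0 pp) ?(smooth_nums_gt0 Hl hb) // (smooth_nums_logn0 _ pp pl hb) //.
by rewrite addn0 pfactorK.
Qed.

Lemma logn_smooth_tail (l : seq nat) b p k q : prime p -> q \in l -> p \notin l ->
  (forall p, p \in l -> prime p) -> (0 < b)%N -> logn q (p ^ k * b) = logn q b.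
Proof.
move=> pp ql pl Hl hb.
rewrite lognM ?expn_gt0 ?(prime_gt0 pp) // lognX logn_prime //.
case: eqP => [e|_]; last by rewrite muln0.
by rewrite -e ql in pl.
Qed.

Lemma smooth_nums_prod l a : uniq l -> (forall p, p \in l -> prime p) -> a \in smooth_nums l ->
  a = (\prod_(p <- l) p ^ logn p a)%N.
Proof.
elim: l a => [|p l IH] a; first by rewrite mem_seq1 big_nil => _ _ /eqP.
move=> /= /andP[pl ul] Hl /allpairsP[[k b] /= [_ hb ->]].
have Hl' r : r \in l -> prime r by move=> rl; apply: Hl; rewrite inE rl orbT.
have pp : prime p by apply: Hl; rewrite mem_head.
have b0 := smooth_nums_gt0 Hl' hb.
rewrite big_cons (logn_smooth_head _ Hl' pp pl hb); congr (_ * _)%N.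
rewrite {1}(IH b) // big_seq [RHS]big_seq; apply: eq_bigr => q ql.
by rewrite (logn_smooth_tail _ pp ql pl Hl' b0).
Qed.

Lemma smooth_nums_uniq l : uniq l -> (forall p, p \in l -> prime p) -> uniq (smooth_nums l).
Proof.
elim: l => [//|p l IH] /= /andP[pl ul] Hl.
have Hl' r : r \in l -> prime r by move=> rl; apply: Hl; rewrite inE rl orbT.
have pp : prime p by apply: Hl; rewrite mem_head.
apply: allpairs_uniq; rewrite ?iota_uniq ?IH //.
move=> [k b] [k' b'] /allpairsP[[x y] /= [_ hy [-> ->]]] /allpairsP[[x' y'] /= [_ hy' [-> ->]]].
move=> e; have ek : x = x'.
  by rewrite -(logn_smooth_head x Hl' pp pl hy) e (logn_smooth_head x' Hl' pp pl hy').
move: e; rewrite -ek => /eqP; rewrite eqn_pmul2l ?expn_gt0 ?prime_gt0 //.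
by move=> /eqP ->.
Qed.

(** A completely additive upper bound for log_2 a on the smooth numbers, so that Rankin sums factor
    exactly over the primes. *)
Definition smooth_bit_size (l : seq nat) (a : nat) : nat := (\sum_(p <- l) logn p a * bit_size p)%N.

Lemma smooth_bit_size_cons l b p k : (forall p, p \in l -> prime p) -> prime p -> p \notin l ->
  b \in smooth_nums l -> smooth_bit_size (p :: l) (p ^ k * b) = (k * bit_size p + smooth_bit_size l b)%N.
Proof.
move=> Hl pp pl hb; rewrite /smooth_bit_size big_cons (logn_smooth_head _ Hl pp pl hb); congr addn.
rewrite big_seq [RHS]big_seq; apply: eq_bigr => q ql.
by rewrite (logn_smooth_tail _ pp ql pl Hl (smooth_nums_gt0 Hl hb)).
Qed.

Lemma smooth_nums_le_exp2 l a : uniq l -> (forall p, p \in l -> prime p) -> a \in smooth_nums l ->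
  (a <= 2 ^ smooth_bit_size l a)%N.
Proof.
move=> ul Hl ha; rewrite {1}(smooth_nums_prod ul Hl ha) /smooth_bit_size expn_sum.
apply: leq_prod => p _; rewrite mulnC expnM.
by case: logn => // n; rewrite leq_exp2r // le_exp2_bit_size.
Qed.

Variable R : realType.

Lemma smooth_nums_rankin (s : R) l : uniq l -> (forall p, p \in l -> prime p) ->
  \sum_(a <- smooth_nums l) expR (s * (smooth_bit_size l a)%:R) / a%:R =
  \prod_(p <- l) \sum_(k <- iota 0 K) (expR (s * (bit_size p)%:R) / p%:R) ^+ k.
Proof.
elim: l => [|p l IH]; first by rewrite !big_nil big_seq1 /smooth_bit_size big_nil mulr0 expR0 divr1.
move=> /= /andP[pl ul] Hl.
have Hl' r : r \in l -> prime r by move=> rl; apply: Hl; rewrite inE rl orbT.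
have pp : prime p by apply: Hl; rewrite mem_head.
rewrite big_smooth_nums big_cons -IH // mulr_suml; apply: eq_bigr => k _.
rewrite mulr_sumr !big_seq; apply: eq_bigr => a ha.
rewrite smooth_bit_size_cons // natrD mulrDr expRD [(p ^ k * a)%:R]natrM natrX invfM expr_div_n -expRM_natr.
have -> : s * (k * bit_size p)%:R = s * (bit_size p)%:R * k%:R by rewrite natrM; ring.
by rewrite mulrACA.
Qed.

Lemma geom_sum_le (r : R) : 0 <= r < 1 -> \sum_(k <- iota 0 K) r ^+ k <= (1 - r)^-1.
Proof.
move=> /andP[r0 r1].
have -> : \sum_(k <- iota 0 K) r ^+ k = (1 - r ^+ K) / (1 - r).
  have h : 1 - r != 0 by rewrite gt_eqF // subr_gt0.
  apply: (mulIf h); rewrite mulfVK //.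
  elim: K => [|k IH]; first by rewrite big_nil mul0r expr0 subrr.
  rewrite -addn1 iotaD big_cat /= mulrDl IH big_seq1 add0n addn1 exprS; ring.
rewrite -[leRHS]mul1r ler_wpM2r ?invr_ge0 ?subr_ge0 ?(ltW r1) //.
by rewrite lerBlDr lerDl exprn_ge0.
Qed.

Lemma sum_inv_smooth_nums_le l : uniq l -> (forall p, p \in l -> prime p) ->
  \sum_(a <- smooth_nums l) (a%:R)^-1 <= expR (2 * \sum_(p <- l) (p%:R)^-1) :> R.
Proof.
move=> ul Hl; have e := smooth_nums_rankin 0 ul Hl.
rewrite (eq_bigr (fun a => expR (0 * (smooth_bit_size l a)%:R) / a%:R)); last first.
  by move=> a _; rewrite mul0r expR0 mul1r.
rewrite e.
rewrite mulr_sumr expR_sum !big_seq; apply: ler_prod => p /Hl pp.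
have h := inv_prime_le_half R pp.
have -> : expR (0 * (bit_size p)%:R) / p%:R = p%:R^-1 :> R by rewrite mul0r expR0 mul1r.
rewrite sumr_ge0 /=; last by move=> k _; rewrite exprn_ge0 // invr_ge0.
apply: le_trans (geom_sum_le _) (inv1B_le_expR h); lra.
Qed.

Lemma ln2_ge_half : 1 / 2 <= ln 2 :> R.
Proof.
rewrite -[leLHS]expRK ler_ln ?posrE ?expR_gt0 //.
have h : 2^-1 <= expR (- (1 / 2)) :> R by have := expR_ge1Dx (- (1 / 2) : R); lra.
by rewrite -[expR _]invrK -expRN -[leRHS]invrK lef_pV2 ?posrE ?invr_gt0 ?expR_gt0.
Qed.

(** * Pointwise and summed error of the Kubilius model *)

Section Kubilius.
Variables (S ps : seq nat) (kap : nat).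
Hypothesis uS : uniq S.
Hypothesis HS : forall p, p \in S -> prime p /\ (lg p <= kap)%N.
Hypothesis pS : perm_eq S ps.
Hypothesis sps : sorted gtn ps.
Variables (L s : R).
Hypothesis L1 : 1 <= L.
Hypothesis Lk : 16 * L <= kap%:R.
Hypothesis sk : s * kap%:R = L.

Let k0 : 0 < kap%:R :> R. Proof. by move: L1 Lk; lra. Qed.
Let s0 : 0 < s. Proof. by rewrite -(pmulr_lgt0 _ k0) sk; move: L1; lra. Qed.
Let s16 : s <= 1 / 16.
Proof. by rewrite -(ler_pM2r k0) sk; move: Lk; lra. Qed.
Let pS' p : p \in S -> prime p. Proof. by move=> /HS[]. Qed.

(** Keeps the geometric series at every prime, 2 included, bounded by 4. As s <= 1/16 and
    [bit_size p <= 2 * lg p], the numerator is at most (8/7)^(lg p), against 2^(lg p) below. *)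
Lemma rankin_ratio_le p : prime p -> expR (s * (bit_size p)%:R) / p%:R <= 3 / 4.
Proof.
move=> pp; have k1 := lg_prime_gt0 pp.
have p0 : 0 < p%:R :> R by rewrite ltr0n prime_gt0.
rewrite ler_pdivrMr //.
have hp : (2 ^ lg p)%:R <= p%:R :> R by rewrite ler_nat trunc_logP // prime_gt0.
have h8 : expR (1 / 8) <= 8 / 7 :> R.
  have := expR_ge1Dx (- (1 / 8) : R); rewrite expRN => h.
  rewrite -[leLHS]invrK; have -> : 8 / 7 = (7 / 8)^-1 :> R by field.
  by rewrite lef_pV2 ?posrE ?invr_gt0 ?expR_gt0 //; lra.
have h1 : expR (s * (bit_size p)%:R) <= expR (1 / 8 * (lg p)%:R).
  rewrite ler_expR /bit_size -[(lg p).+1%:R]natr1.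
  have k1R : 1 <= (lg p)%:R :> R by rewrite ler1n.
  apply: le_trans (_ : 1 / 16 * ((lg p)%:R + 1) <= _); last by move: k1R; lra.
  by rewrite ler_wpM2r // addr_ge0.
apply: le_trans h1 _; rewrite expRM_natr.
apply: le_trans (_ : (8 / 7) ^+ lg p <= _).
  by rewrite lerXn2r ?nnegrE ?expR_ge0 //; lra.
apply: le_trans (_ : 3 / 4 * (2 ^ lg p)%:R <= _); last by rewrite ler_wpM2l //; lra.
rewrite natrX; case: (lg p) k1 => // k _; rewrite !exprS.
have : (8 / 7) ^+ k <= 2 ^+ k :> R by rewrite lerXn2r ?nnegrE //; lra.
have : 0 <= (8 / 7) ^+ k :> R by rewrite exprn_ge0 //; lra.
lra.
Qed.

(** With r the Rankin ratio, (1 - 1/p)/(1 - r) = 1 + (r - 1/p)/(1 - r) <= 1 + 4 (r - 1/p). The Euler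
    product thus removes the divergent sum of 1/p, leaving exactly the sum in [rankin_sum_le]. *)
Lemma smooth_nums_rankin_le :
  euler_prod R S * \sum_(a <- smooth_nums S) expR (s * (smooth_bit_size S a)%:R) / a%:R <= expR (4 * rankin_bound L).
Proof.
rewrite smooth_nums_rankin // /euler_prod -big_split /=.
apply: le_trans (_ : expR (4 * \sum_(p <- S) (expR (s * (bit_size p)%:R) - 1) / p%:R) <= _);
  last by rewrite ler_expR ler_wpM2l // (rankin_sum_le uS HS L1 Lk sk).
rewrite mulr_sumr expR_sum !big_seq; apply: ler_prod => p /pS' pp.
have h := inv_prime_le_half R pp; have hr := rankin_ratio_le pp.
have p0 : 0 < p%:R :> R by rewrite ltr0n prime_gt0.
set r := expR (s * (bit_size p)%:R) / p%:R in hr *.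
have r0 : 0 <= r by rewrite divr_ge0 ?expR_ge0 ?ler0n.
have rp : p%:R^-1 <= r.
  rewrite -[leLHS]mul1r ler_wpM2r ?invr_ge0 ?ler0n // expR_ge1_ge0 //.
  by rewrite mulr_ge0 // ltW.
have v0 : 0 <= 1 - p%:R^-1 :> R by lra.
rewrite mulr_ge0 //=; last by rewrite sumr_ge0 // => k _; rewrite exprn_ge0.
apply: le_trans (ler_wpM2l v0 (geom_sum_le _)) _; first by lra.
apply: le_trans (expR_ge1Dx _).
have -> : 4 * ((expR (s * (bit_size p)%:R) - 1) / p%:R) = 4 * (r - p%:R^-1).
  by rewrite /r; field; rewrite gt_eqF.
rewrite ler_pdivrMr; last lra.
have : (r - p%:R^-1) * (4 * (1 - r)) >= (r - p%:R^-1) * 1.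
  by rewrite ler_wpM2l; lra.
lra.
Qed.

Definition kubilius_factor (u : R) : R :=
  expR (- (L * u) + 77 * L + 9 + rankin_bound L + 64 * expR (L / 2)).

Definition kubilius_err (u : R) (a : nat) : R :=
  2 * kubilius_factor u * (euler_prod R S * (expR (s * (smooth_bit_size S a)%:R) / a%:R)) +
  2 * expR (- (18 * ln 2 * kap%:R)) / a%:R.

Lemma kubilius_pointwise (x u : R) (N a : nat) : (0 < N)%N -> x <= 2 * N%:R ->
  expR (ln 2 * (u * kap%:R)) <= x -> a \in smooth_nums S ->
  euler_prod R S / a%:R - (sieve_count N a 1 ps)%:R / N%:R <= kubilius_err u a.
Proof.
move=> N0 xN ux ha; have a0 := smooth_nums_gt0 pS' ha.
have N0' : 0 < N%:R :> R by rewrite ltr0n.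
have a0' : 0 < a%:R :> R by rewrite ltr0n.
have V0 : 0 < euler_prod R S by apply: euler_prod_gt0.
have ln2 := ln2_ge_half.
have eL1 : 0 <= expR (L / 2) by exact: expR_ge0.
have B0 : 0 <= rankin_bound L.
  by rewrite /rankin_bound addr_ge0 // !mulr_ge0 ?expR_ge0 ?invr_ge0 //; move: L1; lra.
set ta := (smooth_bit_size S a)%:R : R.
(* Here 76 = 54 + 22: 54 covers the growth of the levels, and 2^(-22 kap) absorbs e^(2 kap) <= 2^(4
   kap), leaving the 18 of [kubilius_err]. *)
pose D0 := u * kap%:R - ta - 76 * kap%:R.
have sD0 : s * D0 = L * u - s * ta - 76 * L by rewrite /D0 -sk; ring.
have e2 : 0 <= 2 * expR (- (18 * ln 2 * kap%:R)) / a%:R :> R.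
  by rewrite !mulr_ge0 ?expR_ge0 ?invr_ge0 ?ler0n.
(* No room for a sieve: then [kubilius_factor u * expR (s * ta)] is at least 1, so the error exceeds
   the main term. *)
have [hD|hD] := leP kap.+1%:R D0; last first.
  have c0 : 0 <= (sieve_count N a 1 ps)%:R / N%:R :> R by rewrite divr_ge0 ?ler0n.
  have h1 : 1 <= kubilius_factor u * expR (s * ta).
    rewrite -expRD expR_ge1_ge0 //.
    have : s * D0 <= s * kap.+1%:R by rewrite ler_wpM2l ?(ltW s0) // ltW.
    rewrite sD0 -[kap.+1%:R]natr1 mulrDr sk mulr1; move: s16 B0 eL1 L1; lra.
  rewrite /kubilius_err -/ta.
  have -> : 2 * kubilius_factor u * (euler_prod R S * (expR (s * ta) / a%:R)) =
    (2 * (kubilius_factor u * expR (s * ta))) * (euler_prod R S / a%:R) by ring.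
  have : euler_prod R S / a%:R * 1 <= euler_prod R S / a%:R * (2 * (kubilius_factor u * expR (s * ta))).
    by rewrite ler_wpM2l ?divr_ge0 ?ler0n ?(ltW V0) //; move: h1; lra.
  move: c0 e2; lra.
apply: le_trans (sieve_count_lower_bound uS HS pS sps L1 Lk sk hD N0 a0) _.
rewrite /kubilius_err -/ta; apply: lerD.
  have -> : 2 * kubilius_factor u * (euler_prod R S * (expR (s * ta) / a%:R)) =
    2 * (euler_prod R S / a%:R) * (kubilius_factor u * expR (s * ta)) by ring.
  rewrite ler_wpM2l ?mulr_ge0 ?invr_ge0 ?ler0n ?(ltW V0) //.
  rewrite /sieve_err /kubilius_factor -expRD ler_expR.
  have -> : s * (D0 - kap%:R - 1) = s * D0 - L - s by rewrite -sk; ring.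
  rewrite sD0; move: s16; lra.
have a2 : expR (- (ln 2 * ta)) <= a%:R^-1.
  rewrite expRN lef_pV2 ?posrE ?expR_gt0 // /ta -pow2_expR ler_nat.
  exact: smooth_nums_le_exp2.
rewrite ler_pdivrMr // -expRD.
have -> : ln 2 * (D0 + 54 * kap%:R) + 2 * kap%:R =
  ln 2 * (u * kap%:R) + (- (ln 2 * ta)) + (2 * kap%:R - 22 * ln 2 * kap%:R) by rewrite /D0; ring.
rewrite 2!expRD.
apply: le_trans (_ : (2 * N%:R) * a%:R^-1 * expR (- (18 * ln 2 * kap%:R)) <= _); last first.
  rewrite le_eqVlt; apply/orP; left; apply/eqP; ring.
apply: ler_pM; rewrite ?mulr_ge0 ?expR_ge0 //.
  apply: ler_pM; rewrite ?expR_ge0 //; exact: le_trans ux xN.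
rewrite ler_expR.
have : 1 / 2 * kap%:R <= ln 2 * kap%:R :> R by rewrite ler_wpM2r.
lra.
Qed.

Lemma kubilius_err_ge0 u a : 0 <= kubilius_err u a.
Proof.
have V0 : 0 < euler_prod R S by apply: euler_prod_gt0.
by rewrite addr_ge0 // !mulr_ge0 ?expR_ge0 ?invr_ge0 ?ler0n // ltW.
Qed.

(** Five copies of [rankin_bound L]: one from the sieve and four from the sum over [a]. The 10 is 18
    - 8, since the sum of 1/a is at most e^(4 kap) <= 2^(8 kap). *)
Lemma kubilius_err_sum (u : R) :
  \sum_(a <- smooth_nums S) kubilius_err u a <=
  2 * expR (- (L * u) + 77 * L + 9 + 5 * rankin_bound L + 64 * expR (L / 2)) +
  2 * expR (- (10 * ln 2 * kap%:R)).
Proof.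
rewrite /kubilius_err big_split /=; apply: lerD.
  rewrite -mulr_sumr -mulr_sumr -mulrA ler_wpM2l //.
  apply: le_trans (ler_wpM2l _ smooth_nums_rankin_le) _; first exact: expR_ge0.
  by rewrite /kubilius_factor -expRD ler_expR; lra.
rewrite -mulr_sumr -mulrA ler_wpM2l //.
apply: le_trans (ler_wpM2l _ (sum_inv_smooth_nums_le uS pS')) _; first exact: expR_ge0.
rewrite -expRD ler_expR.
have h1 := sum_inv_le R uS HS; have h2 := ln2_ge_half.
have : 1 / 2 * kap%:R <= ln 2 * kap%:R :> R by rewrite ler_wpM2r.
move: h1; lra.
Qed.

End Kubilius.

(** Every term on the left is O(e^L / L), so it eventually drops below e^L / 4 <= e^(L - 1). The
    second inequality will give 16 L <= [kap] for L at most 1 + ln [kap]. *)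
Lemma rankin_exponent_le : exists2 B : R, 12 <= B & forall L, B <= L ->
  77 * L + 5 * rankin_bound L + 64 * expR (L / 2) <= expR (L - 1) /\
  16 * (1 + L) <= expR L.
Proof.
exists (128 * 128); first lra.
move=> L hL; have L0 : 0 < L by lra.
have h1 : expR L / 4 <= expR (L - 1).
  by rewrite expRB ler_wpM2l ?expR_ge0 // lef_pV2 ?posrE ?expR_gt0 // expR1_le4.
have h2 : 16 * 128 * L <= expR (L / 2).
  have L2 : 0 <= L / 2 by lra.
  have := expR_ge1Dxn 1 L2; rewrite (_ : 2`! = 2)%N // => h'.
  have : L * (128 * 128) <= L * L by rewrite ler_wpM2l // ltW.
  have e : (L / 2) ^+ 2 / 2 = L * L / 8 by field.
  rewrite e in h'; move: h'; lra.
have eL : expR L = expR (L / 2) * expR (L / 2) by rewrite -expRD; congr expR; field.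
have h3 : expR L / L <= expR L / (128 * 128).
  apply: ler_wpM2l; first exact: expR_ge0.
  by rewrite lef_pV2 ?posrE; lra.
have h4 : 16 * 128 * L * expR (L / 2) <= expR L by rewrite eL ler_wpM2r ?expR_ge0.
have h5 : L <= L * expR (L / 2) by rewrite ler_peMr ?ltW // expR_gt1; lra.
have h6 : expR (L / 2) <= L * expR (L / 2) by rewrite ler_peMl ?expR_ge0 //; lra.
have h7 := expR_ge0 L.
split; first by rewrite /rankin_bound; lra.
lra.
Qed.

End SmoothNumbers.

(** * The Stein-Chen method *)

Section PoissonTail.
Variables (R : realType) (lam : R).
Hypothesis lam_gt0 : 0 < lam.
Local Notation ppi := (pois_pmf lam).

Definition pois_cdf (n : nat) : R := \sum_(i < n) ppi i.
Local Notation F := pois_cdf.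

Lemma pois_pmf_gt0 k : 0 < ppi k.
Proof. by rewrite /pois_pmf !mulr_gt0 ?expR_gt0 ?exprn_gt0 ?invr_gt0 // ltr0n fact_gt0. Qed.

Lemma pois_pmf0 : ppi 0 = expR (- lam).
Proof. by rewrite /pois_pmf expr0 fact0 divr1 mulr1. Qed.

Lemma pois_pmfS k : k.+1%:R * ppi k.+1 = lam * ppi k.
Proof.
rewrite /pois_pmf factS natrM exprS.
have h1 : (k`!)%:R != 0 :> R by rewrite pnatr_eq0 -lt0n fact_gt0.
have h2 : k.+1%:R != 0 :> R by rewrite pnatr_eq0.
by field; rewrite h1 addrC natr1.
Qed.

Lemma pois_cdfS n : F n.+1 = F n + ppi n.
Proof. by rewrite /F big_ord_recr. Qed.

Lemma pois_cdf_mono m n : (m <= n)%N -> F m <= F n.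
Proof.
move=> /subnK <-; elim: (n - m)%N => // k IH; rewrite addSn pois_cdfS.
by apply: le_trans IH _; rewrite lerDl ltW // pois_pmf_gt0.
Qed.

Lemma pois_cdf_series n : F n = expR (- lam) * series (exp_coeff lam) n.
Proof.
rewrite /F /series /= big_mkord mulr_sumr; apply: eq_bigr => i _.
by rewrite /pois_pmf /exp_coeff /= mulrA.
Qed.

Lemma pois_cdf_cvg : (F @ \oo --> (1 : R))%classic.
Proof.
have -> : F = (fun n => expR (- lam) * series (exp_coeff lam) n).
  by apply/funext => n; exact: pois_cdf_series.
have -> : 1 = expR (- lam) * expR lam :> R by rewrite -expRD addNr expR0.
by apply: cvgMr; exact: is_cvg_series_exp_coeff.
Qed.

Lemma pois_cdf_le1 n : F n <= 1.
Proof.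
rewrite -(cvg_lim _ pois_cdf_cvg) //.
apply: nondecreasing_cvgn_le; last by apply/cvg_ex; exists 1; exact: pois_cdf_cvg.
by move=> a b ab; exact: pois_cdf_mono.
Qed.

Lemma pois_cdf_near1 (e : R) : 0 < e ->
  exists n0, forall n, (n0 <= n)%N -> 1 - F n <= e.
Proof.
move=> e0; have /cvgrPdist_le /(_ e e0) [n0 _ h] := pois_cdf_cvg.
exists n0 => n hn; apply: le_trans (h n hn).
exact: ler_norm.
Qed.

(** This and [pois_tail_le] give the signs in [stein_sol_diff]. The subtracted [ppi 0] yields the
    bound 1 there when [lam] is small, through 1 - e^(-lam) <= lam. *)
Lemma pois_head_le k : lam * F k <= k%:R * (F k.+1 - ppi 0).
Proof.
have -> : lam * F k = \sum_(i < k) i.+1%:R * ppi i.+1.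
  by rewrite mulr_sumr; apply: eq_bigr => i _; rewrite pois_pmfS.
have -> : F k.+1 - ppi 0 = \sum_(i < k) ppi i.+1.
  by rewrite /F big_ord_recl /= addrAC subrr add0r.
rewrite mulr_sumr; apply: ler_sum => i _.
by rewrite ler_wpM2r ?ler_nat // ltW // pois_pmf_gt0.
Qed.

(** Termwise on finite pieces of the tail, by [pois_pmfS], and then in the limit with an arbitrary
    error [e]. *)
Lemma pois_tail_le k : k%:R * (1 - F k.+1) <= lam * (1 - F k).
Proof.
have h n : k%:R * (F (k.+1 + n)%N - F k.+1) <= lam * (F (k + n)%N - F k).
  elim: n => [|n IH]; first by rewrite !addn0 !subrr !mulr0.
  have e1 : F (k.+1 + n.+1)%N = F (k.+1 + n)%N + ppi (k + n).+1.
    by rewrite addnS pois_cdfS addSn.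
  have e2 : F (k + n.+1)%N = F (k + n)%N + ppi (k + n)%N by rewrite addnS pois_cdfS.
  have : k%:R * ppi (k + n).+1 <= lam * ppi (k + n)%N.
    rewrite -pois_pmfS ler_wpM2r ?(ltW (pois_pmf_gt0 _)) // ler_nat; lia.
  rewrite e1 e2; lra.
apply/ler_addgt0Pr => e e0.
have e1 : 0 < e / (k%:R + 1) by rewrite divr_gt0 // ltr_wpDl.
have [n0 hn0] := pois_cdf_near1 e1.
have h1 := h n0; have h2 := pois_cdf_le1 (k + n0).
have h3 := hn0 (k.+1 + n0)%N (leq_addl _ _).
have h4 : k%:R * (1 - F (k.+1 + n0)%N) <= e.
  apply: le_trans (_ : k%:R * (e / (k%:R + 1)) <= _); first by rewrite ler_wpM2l.
  have kk : 0 < k%:R + 1 :> R by rewrite ltr_wpDl.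
  rewrite mulrA ler_pdivrMr // mulrC ler_wpM2l ?(ltW e0) //; lra.
have h5 : lam * (F (k + n0)%N - F k) <= lam * (1 - F k).
  by rewrite ler_wpM2l ?(ltW lam_gt0) //; lra.
lra.
Qed.

Lemma pois_tail_pmf k : (1 - F k.+1) * ppi 0 <= ppi k.
Proof.
elim: k => [|k IH].
  rewrite -[leRHS]mul1r ler_wpM2r ?(ltW (pois_pmf_gt0 0)) // lerBlDr lerDl.
  by rewrite /F big_ord1 ltW // pois_pmf_gt0.
have k0 : 0 < k.+1%:R :> R by rewrite ltr0n.
rewrite -(ler_pM2l k0) pois_pmfS mulrA.
apply: le_trans (_ : lam * (1 - F k.+1) * ppi 0 <= _).
  by rewrite ler_wpM2r ?pois_tail_le // ltW // pois_pmf_gt0.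
by rewrite -mulrA ler_wpM2l // ltW.
Qed.

Section SteinSolution.
Variables (h : nat -> R) (M : nat).
Hypothesis h01 : forall i, 0 <= h i <= 1.
Hypothesis hM : forall i, (M <= i)%N -> h i = 0.

Let H n : R := \sum_(i < n) h i * ppi i.
Definition pois_mean : R := H M.

Let HS n : H n.+1 = H n + h n * ppi n. Proof. by rewrite /H big_ord_recr. Qed.

Let H_ge0 n : 0 <= H n.
Proof.
apply: sumr_ge0 => i _; have /andP[h0 _] := h01 i.
by rewrite mulr_ge0 // ltW // pois_pmf_gt0.
Qed.

Let H_leF n : H n <= F n.
Proof.
apply: ler_sum => i _; have /andP[_ h1] := h01 i.
by rewrite ler_piMl // ltW // pois_pmf_gt0.
Qed.

Let H_stat n : (M <= n)%N -> H n = pois_mean.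
Proof.
move=> /subnK <-; elim: (n - M)%N => // k IH.
by rewrite addSn HS IH hM ?mul0r ?addr0 // leq_addl.
Qed.

Let tail_bound n : 0 <= pois_mean - H n <= 1 - F n.
Proof.
have [nM|Mn] := leqP n M; last first.
  by rewrite (H_stat (ltnW Mn)) subrr lexx subr_ge0 pois_cdf_le1.
have hh m : (n <= m)%N -> 0 <= H m - H n <= F m - F n.
  elim: m => [|k IH]; first by rewrite leqn0 => /eqP ->; rewrite !subrr lexx.
  rewrite leq_eqVlt => /predU1P[->|]; first by rewrite !subrr lexx.
  rewrite ltnS => /IH; rewrite HS pois_cdfS.
  have /andP[h0 h1] := h01 k; have p0 := ltW (pois_pmf_gt0 k).
  have : h k * ppi k <= ppi k by rewrite ler_piMl.
  have : 0 <= h k * ppi k by rewrite mulr_ge0.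
  lra.
by have := pois_cdf_le1 M; have := hh M nM; rewrite /pois_mean; lra.
Qed.

(* With [h i = 0] for [M <= i] the Poisson mean of [h] is a finite sum. *)
Definition stein_sol (k : nat) : R :=
  if k is k'.+1 then (H k - F k * pois_mean) / (lam * ppi k') else 0.
Local Notation g := stein_sol.

Lemma stein_eq k : lam * g k.+1 - k%:R * g k = h k - pois_mean.
Proof.
have l0 : lam != 0 by rewrite gt_eqF.
case: k => [|k] /=.
  have p0 : ppi 0 != 0 by rewrite gt_eqF // pois_pmf_gt0.
  by rewrite mulr0 subr0 /H /F !big_ord1; field; rewrite p0.
have p0 : ppi k.+1 != 0 by rewrite gt_eqF // pois_pmf_gt0.
have k0 : k.+1%:R != 0 :> R by rewrite pnatr_eq0.
rewrite -[lam * ppi k]pois_pmfS (HS k.+1) (pois_cdfS k.+1).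
by field; rewrite p0 l0 addrC natr1 k0.
Qed.

(** Crude in [lam], but it will only multiply truncation errors, which vanish as [K] grows. *)
Lemma stein_sol_bounded k : `|g k.+1| <= (lam * ppi 0)^-1.
Proof.
have p0 := pois_pmf_gt0 0; have pk := pois_pmf_gt0 k.
have hb : `|H k.+1 - F k.+1 * pois_mean| <= 1 - F k.+1.
  have /andP[t1 t2] := tail_bound k.+1; have f1 := pois_cdf_le1 k.+1.
  have h0 := H_ge0 k.+1; have hF := H_leF k.+1.
  have F0 : 0 <= F k.+1 by apply: le_trans h0 hF.
  have e : H k.+1 - F k.+1 * pois_mean =
     (1 - F k.+1) * H k.+1 - F k.+1 * (pois_mean - H k.+1) by ring.
  have u1 : (1 - F k.+1) * H k.+1 <= 1 - F k.+1.
    by rewrite ler_piMr ?subr_ge0 //; lra.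
  have u2 : F k.+1 * (pois_mean - H k.+1) <= 1 - F k.+1.
    by apply: le_trans t2; rewrite ler_piMl.
  have u3 : 0 <= (1 - F k.+1) * H k.+1 by rewrite mulr_ge0 // subr_ge0.
  have u4 : 0 <= F k.+1 * (pois_mean - H k.+1) by rewrite mulr_ge0.
  rewrite e ler_norml; lra.
have lp : 0 < lam * ppi k by rewrite mulr_gt0.
rewrite /= normrM normfV (gtr0_norm lp) ler_pdivrMr //.
have lp0 : 0 < lam * ppi 0 by rewrite mulr_gt0.
apply: le_trans hb _; rewrite [leRHS]mulrC ler_pdivlMr //.
have := ler_wpM2l (ltW lam_gt0) (pois_tail_pmf k); lra.
Qed.

(** The increment is [h k.+1 * dl] minus nonnegative multiples [a], [b] of the masses of [h] below
    and above k + 1. A constant [h] must give 0, which is the relation [eab]; hence the increment is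
    at most [dl] in absolute value, and both [dl] and [dl * lam] are at most 1. *)
Lemma stein_sol_diff k : `|g k.+2 - g k.+1| <= 2 / (1 + lam).
Proof.
have kk : 0 < k.+1%:R :> R by rewrite ltr0n.
have pk := pois_pmf_gt0 k.+1; have pk' := pois_pmf_gt0 k.
have p0 := pois_pmf_gt0 0.
have eX : 1 - F k.+1 = 1 - F k.+2 + ppi k.+1 by rewrite (pois_cdfS k.+1); ring.
have eY : F k.+2 = F k.+1 + ppi k.+1 by rewrite (pois_cdfS k.+1).
have X0 : 0 <= 1 - F k.+2 by rewrite subr_ge0 pois_cdf_le1.
have Y0 : 0 <= F k.+1 by apply: le_trans (H_ge0 _) (H_leF _).
set X := 1 - F k.+2 in X0 eX; set Y' := F k.+1 in Y0 eX eY.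
set p := ppi k.+1 in pk eX eY.
have tl : k.+1%:R * X <= lam * (X + p).
  by have := pois_tail_le k.+1; rewrite -/X -/Y' eX.
have hd : lam * Y' <= k.+1%:R * (Y' + p - ppi 0).
  by have := pois_head_le k.+1; rewrite -/Y' eY.
have hY : X + Y' + p = 1 by move: eX; lra.
have /andP[T0 T1] := tail_bound k.+2; rewrite -/X in T1.
have H0 := H_ge0 k.+1; have H1 := H_leF k.+1; rewrite -/Y' in H1.
have /andP[q0 q1] := h01 k.+1.
have l0 : lam != 0 by rewrite gt_eqF.
have pn : p != 0 by rewrite gt_eqF.
have kn : k.+1%:R != 0 :> R by rewrite gt_eqF.
set T := pois_mean - H k.+2 in T0 T1.
pose a := (lam * (X + p) - k.+1%:R * X) / (lam * k.+1%:R * p).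
pose b := (k.+1%:R * (Y' + p) - lam * Y') / (lam * k.+1%:R * p).
have D0 : 0 < lam * k.+1%:R * p by apply: mulr_gt0 => //; exact: mulr_gt0.
have a0 : 0 <= a by apply: divr_ge0; [rewrite subr_ge0|exact: ltW].
have b0 : 0 <= b.
  apply: divr_ge0; last exact: ltW.
  rewrite subr_ge0; apply: le_trans hd _; rewrite ler_wpM2l ?(ltW kk) //; lra.
pose dl := X / lam + Y' / k.+1%:R.
have eD : g k.+2 - g k.+1 = h k.+1 * dl - H k.+1 * a - T * b.
  rewrite /= -[lam * ppi k]pois_pmfS -/p eY -/Y'.
  have -> : pois_mean = H k.+1 + h k.+1 * p + T by rewrite /T (HS k.+1) -/p; ring.
  have -> : H k.+2 = H k.+1 + h k.+1 * p by rewrite (HS k.+1).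
  rewrite /dl /a /b.
  have -> : X = 1 - Y' - p by move: hY; lra.
  by field; rewrite pn l0 addrC natr1 kn.
have eab : Y' * a + X * b = dl.
  rewrite /a /b /dl; have -> : X = 1 - Y' - p by move: hY; lra.
  by field; rewrite pn l0 addrC natr1 kn.
have dl0 : 0 <= dl by rewrite addr_ge0 // divr_ge0 // ltW.
have h1 : H k.+1 * a <= Y' * a by rewrite ler_wpM2r.
have h2 : T * b <= X * b by rewrite ler_wpM2r.
have h3 : 0 <= H k.+1 * a by rewrite mulr_ge0.
have h4 : 0 <= T * b by rewrite mulr_ge0.
have h5 : h k.+1 * dl <= dl by rewrite ler_piMl.
have h6 : 0 <= h k.+1 * dl by rewrite mulr_ge0.
have hN : `|g k.+2 - g k.+1| <= dl by rewrite eD ler_norml; lra.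
apply: le_trans hN _.
have dll : dl * lam <= 1 - ppi 0.
  have : Y' / k.+1%:R * lam <= Y' + p - ppi 0.
    by rewrite mulrAC ler_pdivrMr // mulrC [leRHS]mulrC.
  have -> : 1 - ppi 0 = X + (Y' + p - ppi 0) by rewrite -hY; ring.
  by rewrite /dl mulrDl mulfVK // lerD2l.
have e1 : 1 - ppi 0 <= lam by rewrite pois_pmf0; have := expR_ge1Dx (- lam); lra.
have dl1 : dl <= 1 by rewrite -(ler_pM2r lam_gt0) mul1r; exact: le_trans dll e1.
rewrite ler_pdivlMr; last by rewrite addr_gt0.
rewrite mulrDr mulr1; apply: le_trans (lerD dl1 dll) _.
have -> : 2 = 1 + 1 :> R by ring.
by rewrite lerD2l lerBlDr lerDl ltW.
Qed.

End SteinSolution.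
End PoissonTail.

(** * Sums of independent Bernoulli or geometric variables against Poisson *)

Section Model.
Variables (R : realType) (K : nat) (om : bool).

Definition pcount (k : nat) : nat := if om then k else (0 < k)%N.

(* The total mass is only [1 - p^-K], as exponents stop at [K]. *)
Definition geom_weight (p k : nat) : R := (1 - p%:R^-1) * p%:R^-1 ^+ k.

(** Expectation of [h] at the sum of the [pcount] of independent exponents, nested so that one prime
    is conditioned on at a time. *)
Fixpoint model_expect (T : seq nat) (h : nat -> R) {struct T} : R :=
  if T is p :: T' then \sum_(k < K) geom_weight p k * model_expect T' (fun w => h (pcount k + w)%N)
  else h 0%N.

Lemma eq_model_expect T h h' : h =1 h' -> model_expect T h = model_expect T h'.
Proof.
elim: T h h' => [|p T IH] h h' e /=; first exact: e.
by apply: eq_bigr => k _; congr (_ * _); apply: IH => w; exact: e.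
Qed.

Lemma model_expect_sum (I : Type) (r : seq I) (c : I -> R) (f : I -> nat -> R) T :
  model_expect T (fun w => \sum_(i <- r) c i * f i w) = \sum_(i <- r) c i * model_expect T (f i).
Proof.
elim: T f => [//|p T IH] f /=.
under [RHS]eq_bigr do rewrite mulr_sumr.
rewrite exchange_big /=; apply: eq_bigr => k _; rewrite IH mulr_sumr.
by apply: eq_bigr => i _; rewrite mulrCA.
Qed.

Lemma model_expect_lin2 (a b : R) (f f' : nat -> R) T :
  model_expect T (fun w => a * f w + b * f' w) = a * model_expect T f + b * model_expect T f'.
Proof.
have := @model_expect_sum bool [:: true; false] (fun i => if i then a else b)
  (fun i => if i then f else f') T.
rewrite !big_cons !big_nil /= !addr0 => <-.
by apply: eq_model_expect => w; rewrite !big_cons !big_nil /= addr0.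
Qed.

Lemma geom_weight_ge0 p k : prime p -> 0 <= geom_weight p k.
Proof.
by move=> /(inv_prime_le_half R) h; rewrite mulr_ge0 ?exprn_ge0 //; lra.
Qed.

Lemma geom_weight_sum p n : prime p -> \sum_(k < n) geom_weight p k = 1 - p%:R^-1 ^+ n.
Proof.
move=> pp; elim: n => [|n IH]; first by rewrite big_ord0 expr0 subrr.
by rewrite big_ord_recr /= IH /geom_weight exprS; ring.
Qed.

Lemma geom_weight_sum_le1 p : prime p -> \sum_(k < K) geom_weight p k <= 1.
Proof.
move=> pp; rewrite geom_weight_sum // lerBlDr lerDl exprn_ge0 //.
Qed.

Lemma model_expect_bound T (f : nat -> R) c : (forall p, p \in T -> prime p) -> 0 <= c ->
  (forall w, `|f w| <= c) -> `|model_expect T f| <= c.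
Proof.
move=> + c0; elim: T f => [|p T IH] f HT Hf /=; first exact: Hf.
have pp : prime p by apply: HT; rewrite mem_head.
have HT' q : q \in T -> prime q by move=> qT; apply: HT; rewrite inE qT orbT.
apply: le_trans (ler_norm_sum _ _ _) _.
apply: le_trans (_ : \sum_(k < K) geom_weight p k * c <= _).
  apply: ler_sum => k _; rewrite normrM ger0_norm ?geom_weight_ge0 // ler_wpM2l ?geom_weight_ge0 //.
  by apply: IH => // w; exact: Hf.
by rewrite -mulr_suml ler_piMl // geom_weight_sum_le1.
Qed.

Lemma model_expect_ge0 T (f : nat -> R) : (forall p, p \in T -> prime p) ->
  (forall w, 0 <= f w) -> 0 <= model_expect T f.
Proof.
elim: T f => [|p T IH] f HT Hf /=; first exact: Hf.
have pp : prime p by apply: HT; rewrite mem_head.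
have HT' q : q \in T -> prime q by move=> qT; apply: HT; rewrite inE qT orbT.
apply: sumr_ge0 => k _; rewrite mulr_ge0 ?geom_weight_ge0 //.
by apply: IH => // w; exact: Hf.
Qed.

Lemma model_expect1_bounds T : (forall p, p \in T -> prime p) ->
  1 - \sum_(p <- T) p%:R^-1 ^+ K <= model_expect T (fun=> 1) <= 1.
Proof.
elim: T => [|p T IH] HT /=; first by rewrite big_nil subr0 lexx.
have pp : prime p by apply: HT; rewrite mem_head.
have HT' q : q \in T -> prime q by move=> qT; apply: HT; rewrite inE qT orbT.
have /andP[h1 h2] := IH HT'; have h0 := @model_expect_ge0 T (fun=> 1) HT' (fun=> ler01).
rewrite -mulr_suml geom_weight_sum // big_cons.
have a0 : 0 <= p%:R^-1 ^+ K :> R by rewrite exprn_ge0 // invr_ge0.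
have a1 : p%:R^-1 ^+ K * model_expect T (fun=> 1) <= p%:R^-1 ^+ K by rewrite ler_piMr.
have a2 : 0 <= p%:R^-1 ^+ K * model_expect T (fun=> 1) by rewrite mulr_ge0.
lra.
Qed.

(** The mean of [pcount] of the untruncated exponent of p. *)
Definition prime_lam (p : nat) : R := if om then (p%:R - 1)^-1 else p%:R^-1.
Definition set_lam (T : seq nat) : R := \sum_(p <- T) prime_lam p.

Section PrimeStep.
Variables (g : nat -> R) (dl G : R).
Hypothesis gG : forall j, `|g j.+1| <= G.
Hypothesis gd : forall j, `|g j.+2 - g j.+1| <= dl.

Let dl0 : 0 <= dl. Proof. exact: le_trans (gd 0). Qed.
Let G0 : 0 <= G. Proof. exact: le_trans (gG 0). Qed.

Lemma dist_le_of_increments k : `|g k.+1 - g 1%N| <= dl * k%:R.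
Proof.
elim: k => [|k IH]; first by rewrite subrr normr0 mulr0.
have -> : g k.+2 - g 1%N = (g k.+2 - g k.+1) + (g k.+1 - g 1%N) by ring.
apply: le_trans (ler_normD _ _) _; rewrite -[k.+1%:R]natr1 mulrDr mulr1 addrC.
exact: lerD.
Qed.

Lemma quad_half_sum n :
  \sum_(k < n) (4 * k%:R ^+ 2 - 2 * k%:R) * (1 / 2) ^+ k =
  20 - (8 * n%:R ^+ 2 + 12 * n%:R + 20) * (1 / 2) ^+ n :> R.
Proof.
elim: n => [|n IH]; first by rewrite big_ord0 expr0; ring.
by rewrite big_ord_recr /= IH [(1 / 2) ^+ n.+1]exprS -[n.+1%:R]natr1; field.
Qed.

(** A factor a^2 comes out of every term; the rest increases with a and is taken at a = 1/2, where
    the series sums to 20. *)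
Lemma quad_pow_le (a : R) k : 0 <= a <= 1 / 2 ->
  k%:R * a ^+ k.+1 + k%:R * (k%:R - 1) * a ^+ k <=
  a ^+ 2 * ((4 * k%:R ^+ 2 - 2 * k%:R) * (1 / 2) ^+ k).
Proof.
move=> /andP[a0 a1]; case: k => [|[|k]].
- by rewrite !mul0r expr0; lra.
- by rewrite expr1; lra.
have e1 : a ^+ k <= (1 / 2) ^+ k by rewrite lerXn2r ?nnegrE //; lra.
have e2 : a ^+ k.+1 <= (1 / 2) ^+ k.+1 by rewrite lerXn2r ?nnegrE //; lra.
have kk : 0 <= k.+2%:R :> R by rewrite ler0n.
have kk1 : 0 <= k.+2%:R - 1 :> R by rewrite -[k.+2%:R]natr1 addrK ler0n.
have -> : k.+2%:R * a ^+ k.+3 + k.+2%:R * (k.+2%:R - 1) * a ^+ k.+2 =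
  a ^+ 2 * (k.+2%:R * a ^+ k.+1 + k.+2%:R * (k.+2%:R - 1) * a ^+ k) by rewrite !exprS expr0; ring.
rewrite ler_wpM2l ?exprn_ge0 //.
have -> : (4 * k.+2%:R ^+ 2 - 2 * k.+2%:R) * (1 / 2) ^+ k.+2 =
   k.+2%:R * (1 / 2) ^+ k.+1 + k.+2%:R * (k.+2%:R - 1) * (1 / 2) ^+ k :> R.
  by rewrite !exprS; field.
by apply: lerD; rewrite ler_wpM2l // mulr_ge0.
Qed.

(** Stein's operator at a single prime. It kills constants up to truncation, because [prime_lam p]
    is the mean; so only the increments of [g] matter, with weights of order 1/p^2. *)
Lemma prime_step p : prime p -> (0 < K)%N ->
  `|\sum_(k < K) geom_weight p k * (prime_lam p * g (pcount k).+1 - (pcount k)%:R * g (pcount k))|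
  <= 20 * dl * p%:R^-1 ^+ 2 + G * (K%:R + 2) * p%:R^-1 ^+ K.
Proof.
move=> pp K0; have /andP[a0 a1] := inv_prime_le_half R pp.
have p0 : p%:R != 0 :> R by rewrite pnatr_eq0 -lt0n prime_gt0.
have p1 : p%:R - 1 != 0 :> R.
  by rewrite subr_eq0 pnatr_eq1; apply/negP => /eqP h; move: pp; rewrite h.
rewrite /prime_lam /geom_weight /pcount; set a := p%:R^-1 in a0 a1 *.
have aK0 : 0 <= a ^+ K by rewrite exprn_ge0.
case: om.
  have la : (1 - a) * (p%:R - 1)^-1 = a by rewrite /a; field; rewrite p0 p1.
  (* Centring at [g 1]: the coefficients add up to [K%:R * a ^+ K], the effect of the truncation
     alone. *)
  have -> : \sum_(k < K) (1 - a) * a ^+ k * ((p%:R - 1)^-1 * g k.+1 - k%:R * g k) =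
     g 1%N * (K%:R * a ^+ K) +
     \sum_(k < K) (a ^+ k.+1 * (g k.+1 - g 1%N) - (1 - a) * k%:R * a ^+ k * (g k - g 1%N)).
    have -> : K%:R * a ^+ K = \sum_(k < K) (a ^+ k.+1 - (1 - a) * k%:R * a ^+ k).
      elim: {K0 aK0} K => [|n IH]; first by rewrite big_ord0 mul0r.
      by rewrite big_ord_recr /= -IH exprS -[n.+1%:R]natr1; ring.
    rewrite mulr_sumr -big_split /=; apply: eq_bigr => k _.
    have -> : (1 - a) * a ^+ k * ((p%:R - 1)^-1 * g k.+1 - k%:R * g k) =
      ((1 - a) * (p%:R - 1)^-1) * a ^+ k * g k.+1 - (1 - a) * k%:R * a ^+ k * g k by ring.
    by rewrite la exprS; ring.
  apply: le_trans (ler_normD _ _) _; rewrite addrC; apply: lerD; last first.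
    rewrite normrM [X in _ * X]ger0_norm ?mulr_ge0 // mulrA.
    rewrite ler_wpM2r //; apply: ler_pM => //; lra.
  apply: le_trans (ler_norm_sum _ _ _) _.
  apply: le_trans (_ : \sum_(k < K) dl * (a ^+ 2 * ((4 * k%:R ^+ 2 - 2 * k%:R) * (1 / 2) ^+ k)) <= _).
    apply: ler_sum => k _.
    have ha : 0 <= a <= 1 / 2 by rewrite a0.
    apply: le_trans (ler_wpM2l dl0 (quad_pow_le k ha)).
    apply: le_trans (ler_normB _ _) _; rewrite [leRHS]mulrDr; apply: lerD.
      rewrite normrM ger0_norm ?exprn_ge0 // mulrC mulrA ler_wpM2r ?exprn_ge0 //.
      exact: dist_le_of_increments.
    case: (val k) => [|n]; first by rewrite mulr0 !mul0r mulr0 normr0.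
    rewrite normrM ger0_norm; last by rewrite !mulr_ge0 ?exprn_ge0 //; lra.
    have -> : dl * (n.+1%:R * (n.+1%:R - 1) * a ^+ n.+1) =
       (1 * n.+1%:R * a ^+ n.+1) * (dl * n%:R) by rewrite -[n.+1%:R]natr1; ring.
    apply: ler_pM; rewrite ?normr_ge0 ?mulr_ge0 ?exprn_ge0 //; [lra| |exact: dist_le_of_increments].
    by rewrite ler_wpM2r ?exprn_ge0 // ler_wpM2r //; lra.
  rewrite -!mulr_sumr quad_half_sum.
  have -> : 20 * dl * a ^+ 2 = dl * (a ^+ 2 * 20) by ring.
  have q0 : 0 <= 8 * K%:R ^+ 2 + 12 * K%:R + 20 :> R.
    by rewrite addr_ge0 // addr_ge0 // mulr_ge0 // exprn_ge0.
  have q1 : 0 <= (1 / 2) ^+ K :> R by rewrite exprn_ge0 // divr_ge0.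
  by rewrite ler_wpM2l // ler_wpM2l ?exprn_ge0 // lerBlDr lerDl mulr_ge0.
have -> : \sum_(k < K) (1 - a) * a ^+ k *
    (a * g (0 < k).+1 - (0 < k)%:R * g (0 < k)%N) =
  a ^+ 2 * (g 2%N - g 1%N) + a ^+ K * g 1%N - a ^+ K * a * g 2%N.
  case: {aK0} K K0 => // n _; rewrite big_ord_recl /= expr0 mulr1 mul0r subr0.
  rewrite -mulr_suml.
  have -> : \sum_(i < n) (1 - a) * a ^+ bump 0 i = a - a ^+ n.+1.
    elim: n => [|n IH]; first by rewrite big_ord0 expr1 subrr.
    by rewrite big_ord_recr /= IH /bump /= add1n !exprS; ring.
  by rewrite mul1r; ring.
apply: le_trans (ler_normB _ _) _.
apply: le_trans (lerD (ler_normD _ _) (lexx _)) _.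
have aKa0 : 0 <= a ^+ K * a by rewrite mulr_ge0.
rewrite (normrM (a ^+ 2)) (normrM (a ^+ K)) (normrM (a ^+ K * a)).
rewrite (ger0_norm (exprn_ge0 2 a0)) (ger0_norm aK0) (ger0_norm aKa0).
have h1 := gd 0; have h2 := gG 0; have h3 := gG 1.
have u1 : a ^+ 2 * `|g 2%N - g 1%N| <= 20 * dl * a ^+ 2.
  rewrite mulrC ler_wpM2r ?exprn_ge0 //; move: dl0; lra.
have u2 : a ^+ K * `|g 1%N| <= G * a ^+ K by rewrite mulrC ler_wpM2r.
have u3 : a ^+ K * a * `|g 2%N| <= G * a ^+ K.
  apply: le_trans (ler_wpM2l aKa0 h3) _; rewrite mulrC ler_wpM2l //.
  by rewrite ler_piMr //; lra.
have u4 : 0 <= G * K%:R * a ^+ K by rewrite !mulr_ge0.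
lra.
Qed.

End PrimeStep.

(** Stein's operator is additive over the primes. Given the other exponents, a prime sees a shift of
    [g], and shifts keep both hypotheses on [g]. *)
Lemma model_expect_stein_le T (g : nat -> R) dl G : (0 < K)%N -> (forall p, p \in T -> prime p) ->
  (forall j, `|g j.+1| <= G) -> (forall j, `|g j.+2 - g j.+1| <= dl) ->
  `|model_expect T (fun w => set_lam T * g w.+1 - w%:R * g w)| <=
  \sum_(p <- T) (20 * dl * p%:R^-1 ^+ 2 + G * (K%:R + 2) * p%:R^-1 ^+ K).
Proof.
move=> K0; elim: T g => [|p T IH] g HT gG gd.
  by rewrite /= /set_lam !big_nil !mul0r subrr normr0.
have pp : prime p by apply: HT; rewrite mem_head.
have HT' q : q \in T -> prime q by move=> qT; apply: HT; rewrite inE qT orbT.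
have G0 : 0 <= G by exact: le_trans (gG 0).
have dl0 : 0 <= dl by exact: le_trans (gd 0).
pose B : R := \sum_(p <- T) (20 * dl * p%:R^-1 ^+ 2 + G * (K%:R + 2) * p%:R^-1 ^+ K).
have t0 (q : nat) : 0 <= 20 * dl * q%:R^-1 ^+ 2 + G * (K%:R + 2) * q%:R^-1 ^+ K.
  have q0 n : 0 <= q%:R^-1 ^+ n :> R by rewrite exprn_ge0 // invr_ge0.
  have K2 : 0 <= K%:R + 2 :> R by rewrite addr_ge0.
  by apply: addr_ge0; apply: mulr_ge0 => //; apply: mulr_ge0.
have B0 : 0 <= B by apply: sumr_ge0.
have -> : model_expect (p :: T) (fun w => set_lam (p :: T) * g w.+1 - w%:R * g w) =
  \sum_(k < K) geom_weight p k * model_expect T (fun w => set_lam T * g (pcount k + w).+1 - w%:R * g (pcount k + w)%N) +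
  model_expect T (fun w => \sum_(k < K) geom_weight p k *
     (prime_lam p * g (pcount k + w).+1 - (pcount k)%:R * g (pcount k + w)%N)).
  rewrite model_expect_sum -big_split /=; apply: eq_bigr => k _; rewrite -mulrDr; congr (_ * _).
  have := model_expect_lin2 1 1 (fun w => set_lam T * g (pcount k + w).+1 - w%:R * g (pcount k + w)%N)
    (fun w => prime_lam p * g (pcount k + w).+1 - (pcount k)%:R * g (pcount k + w)%N) T.
  rewrite !mul1r => <-; apply: eq_model_expect => w.
  by rewrite {1}/set_lam big_cons -/(set_lam T) natrD; ring.
rewrite big_cons addrC; apply: le_trans (ler_normD _ _) _; apply: lerD.
  apply: model_expect_bound => //.
  move=> w; have := @prime_step (fun j => g (j + w)%N) dl G _ _ p pp K0.
  apply => j; rewrite !addSn //.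
apply: le_trans (ler_norm_sum _ _ _) _.
apply: le_trans (_ : \sum_(k < K) geom_weight p k * B <= _); last first.
  by rewrite -mulr_suml ler_piMl // geom_weight_sum_le1.
apply: ler_sum => k _; rewrite normrM ger0_norm ?geom_weight_ge0 // ler_wpM2l ?geom_weight_ge0 //.
have := IH (fun w => g (pcount k + w)%N) HT' _ _.
rewrite (@eq_model_expect T _ (fun w => set_lam T * g (pcount k + w).+1 - w%:R * g (pcount k + w)%N)); last first.
  by move=> w /=; rewrite addnS.
by apply => j; rewrite !addnS.
Qed.

(** Dictionary between the two sides of the proof: under the weight [euler_prod R T / a] the
    exponents of [a] are independent and geometric. *)
Lemma smooth_nums_model_expect T (h : nat -> R) : uniq T -> (forall p, p \in T -> prime p) ->
  euler_prod R T * \sum_(a <- smooth_nums K T) h (\sum_(p <- T) pcount (logn p a))%N / a%:R = model_expect T h.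
Proof.
elim: T h => [|p T IH] h.
  by move=> _ _; rewrite /euler_prod big_nil mul1r big_seq1 big_nil divr1.
rewrite cons_uniq => /andP[pT uT] HT.
have pp : prime p by apply: HT; rewrite mem_head.
have HT' q : q \in T -> prime q by move=> qT; apply: HT; rewrite inE qT orbT.
rewrite big_smooth_nums [RHS]/=.
have -> : \sum_(k < K) geom_weight p k * model_expect T (fun w => h (pcount k + w)%N) =
   \sum_(k <- iota 0 K) geom_weight p k * model_expect T (fun w => h (pcount k + w)%N).
  by rewrite -[iota 0 K](_ : index_iota 0 K = _) ?big_mkord // /index_iota subn0.
rewrite mulr_sumr; apply: eq_bigr => k _; rewrite -IH // /euler_prod big_cons -/(euler_prod R T) /geom_weight.
rewrite -!mulrA; congr (_ * _); rewrite mulrCA; congr (_ * _).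
rewrite mulr_sumr !big_seq; apply: eq_bigr => a ha.
rewrite big_cons (logn_smooth_head _ HT' pp pT ha).
have -> : (\sum_(j <- T) pcount (logn j (p ^ k * a)) = \sum_(j <- T) pcount (logn j a))%N.
  rewrite big_seq [RHS]big_seq; apply: eq_bigr => q qT.
  by rewrite (logn_smooth_tail _ pp qT pT HT' (smooth_nums_gt0 HT' ha)).
by rewrite natrM natrX invfM -exprVn mulrCA.
Qed.

End Model.

Section OneDimensional.
Variables (R : realType) (K : nat) (om : bool) (T : seq nat).
Hypothesis K0 : (0 < K)%N.
Hypothesis HT : forall p, p \in T -> prime p.
Hypothesis T0 : T != [::].

Local Notation lam := (set_lam R om T).
Local Notation E := (@model_expect R K om T).

Lemma set_lamE : lam = if om then Hs' R T else Hs R T.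
Proof. by rewrite /set_lam /prime_lam /Hs' /Hs; case: om. Qed.

Lemma Hs_gt0 : 0 < Hs R T.
Proof.
case: T T0 HT => // p l _ H; rewrite /Hs big_cons ltr_pwDl //.
  by rewrite invr_gt0 ltr0n prime_gt0 // H // mem_head.
by apply: sumr_ge0 => q _; rewrite invr_ge0.
Qed.

Lemma Hs_le_set_lam : Hs R T <= lam.
Proof.
rewrite /Hs /set_lam !big_seq; apply: ler_sum => p /HT pp; rewrite /prime_lam.
have p2 : 2 <= p%:R :> R by rewrite ler_nat prime_gt1.
by case: om => //; rewrite lef_pV2 ?posrE; lra.
Qed.

Lemma set_lam_gt0 : 0 < lam.
Proof. exact: lt_le_trans Hs_gt0 Hs_le_set_lam. Qed.

(* Error due to the truncation of the exponents at [K]. *)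
Definition tv_eps : R :=
  ((lam * pois_pmf lam 0)^-1 + 1) * (K%:R + 2) * \sum_(p <- T) p%:R^-1 ^+ K.

Definition tv_bound : R := 40 * (Hs'' R T / (1 + Hs R T)) + tv_eps.

(** Here 40 = 20 * 2, from [prime_step] and [stein_sol_diff]; and [lam] is at least H(T) in both
    cases, so 1 + H(T) may stand in the denominator. *)
Lemma model_expect_tv_test (h : nat -> R) M :
  (forall i, 0 <= h i <= 1) -> (forall i, (M <= i)%N -> h i = 0) ->
  `|E h - \sum_(i < M) h i * pois_pmf lam i| <= tv_bound.
Proof.
move=> h01 hM; have l0 := set_lam_gt0.
pose g := stein_sol lam h M.
pose mu := pois_mean lam h M.
have mu01 : 0 <= mu <= 1.
  apply/andP; split.
    apply: sumr_ge0 => i _; have /andP[? _] := h01 i.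
    by rewrite mulr_ge0 // ltW // pois_pmf_gt0.
  apply: le_trans (pois_cdf_le1 l0 M); apply: ler_sum => i _; have /andP[_ ?] := h01 i.
  by rewrite ler_piMl // ltW // pois_pmf_gt0.
rewrite -[X in _ - X]/mu.
(* The model has mass slightly below 1, hence the correction to Stein's identity. *)
have hE : E h - mu = E (fun w => lam * g w.+1 - w%:R * g w) - mu * (1 - E (fun=> 1)).
  have := model_expect_lin2 K om 1 (- mu) h (fun=> 1) T.
  rewrite (@eq_model_expect R K om T _ (fun w => lam * g w.+1 - w%:R * g w)) => [->|w]; first by ring.
  by rewrite (stein_eq l0) mul1r mulr1.
have /andP[e1 e2] := model_expect1_bounds R K om HT.
have hg := @model_expect_stein_le R K om T g (2 / (1 + lam)) (lam * pois_pmf lam 0)^-1 K0 HT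
  (stein_sol_bounded l0 h01 hM) (stein_sol_diff l0 h01 hM).
rewrite hE; apply: le_trans (ler_normB _ _) _.
have G0 : 0 <= (lam * pois_pmf lam 0)^-1.
  by rewrite invr_ge0 mulr_ge0 ?(ltW l0) // ltW // pois_pmf_gt0.
set G := (lam * pois_pmf lam 0)^-1 in hg G0.
set P := \sum_(p <- T) p%:R^-1 ^+ K : R.
rewrite -/P in e1.
have P0 : 0 <= P by apply: sumr_ge0 => p _; rewrite exprn_ge0 // invr_ge0.
have h2 : `|mu * (1 - E (fun=> 1))| <= P.
  have /andP[m0 m1] := mu01.
  rewrite normrM (ger0_norm m0) ger0_norm ?subr_ge0 //.
  apply: le_trans (_ : 1 * P <= _); last by rewrite mul1r.
  by apply: ler_pM => //; rewrite ?subr_ge0 //; lra.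
have h3 : \sum_(p <- T) (20 * (2 / (1 + lam)) * p%:R^-1 ^+ 2 +
      G * (K%:R + 2) * p%:R^-1 ^+ K) = 40 * (Hs'' R T / (1 + lam)) + G * (K%:R + 2) * P.
  rewrite big_split /= -!mulr_sumr -/P; congr (_ + _).
  rewrite /Hs''; under eq_bigr do rewrite exprVn.
  by ring.
rewrite h3 in hg; rewrite /tv_bound /tv_eps -/G -/P.
have H0 : 0 <= Hs'' R T.
  by apply: sumr_ge0 => p _; rewrite invr_ge0 exprn_ge0.
have h4 : Hs'' R T / (1 + lam) <= Hs'' R T / (1 + Hs R T).
  have := Hs_le_set_lam; have := Hs_gt0 => a b.
  by rewrite ler_wpM2l // lef_pV2 ?posrE; lra.
have K2 : 0 <= K%:R * P by rewrite mulr_ge0.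
move: hg h2 h4; lra.
Qed.

Definition model_pmf (k : nat) : R := E (fun w => (w == k)%:R).

Lemma model_pmf_ge0 k : 0 <= model_pmf k.
Proof. by apply: model_expect_ge0. Qed.

Lemma model_expect_supp (h : nat -> R) M : (forall i, (M <= i)%N -> h i = 0) ->
  E h = \sum_(k < M) h k * model_pmf k.
Proof.
move=> hM; rewrite /model_pmf -(@model_expect_sum R K om _ (index_enum _) (fun k : 'I_M => h k)
  (fun k w => (w == k)%:R)).
apply: eq_model_expect => w; have [hw|hw] := leqP M w.
  rewrite hM // big1 // => k _; case: eqP => [e|]; last by rewrite mulr0.
  by move: hw; rewrite e leqNgt ltn_ord.
rewrite (bigD1 (Ordinal hw)) //= eqxx mulr1 big1 ?addr0 // => k hk.
case: eqP => [e|]; last by rewrite mulr0.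
by move: hk; rewrite -val_eqE /= e eqxx.
Qed.

Lemma model_pmf_sum_le1 M : \sum_(k < M) model_pmf k <= 1.
Proof.
have := @model_expect_supp (fun k => (k < M)%N%:R) M.
rewrite (eq_bigr (fun k : 'I_M => model_pmf k)); last by move=> k _; rewrite ltn_ord mul1r.
move=> <-; last by move=> i; rewrite leqNgt => /negbTE ->.
apply: le_trans (ler_norm _) _; apply: model_expect_bound => // w.
by rewrite normr_nat; case: (_ < _)%N.
Qed.

Lemma model_pois_l1 M : \sum_(k < M) `|model_pmf k - pois_pmf lam k| <= 2 * tv_bound.
Proof.
pose hp (k : nat) : R := ((k < M)%N && (pois_pmf lam k <= model_pmf k))%:R.
pose hm (k : nat) : R := ((k < M)%N && (model_pmf k < pois_pmf lam k))%:R.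
have b01 (b : bool) : 0 <= (b%:R : R) <= 1 by case: b; rewrite /= ?lexx ?ler01.
have hpM i : (M <= i)%N -> hp i = 0 by rewrite /hp leqNgt => /negbTE ->.
have hmM i : (M <= i)%N -> hm i = 0 by rewrite /hm leqNgt => /negbTE ->.
have h1 := @model_expect_tv_test hp M (fun i => b01 _) hpM.
have h2 := @model_expect_tv_test hm M (fun i => b01 _) hmM.
rewrite (model_expect_supp hpM) -sumrB in h1; rewrite (model_expect_supp hmM) -sumrB in h2.
have -> : \sum_(k < M) `|model_pmf k - pois_pmf lam k| =
  \sum_(k < M) (hp k * model_pmf k - hp k * pois_pmf lam k) -
  \sum_(k < M) (hm k * model_pmf k - hm k * pois_pmf lam k).
  rewrite -sumrB; apply: eq_bigr => k _; rewrite /hp /hm ltn_ord /=.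
  case: (leP (pois_pmf lam k) (model_pmf k)) => hk /=.
    by rewrite ger0_norm ?subr_ge0 // !mul1r !mul0r !subr0.
  by rewrite ltr0_norm ?subr_lt0 // !mul1r !mul0r subr0 sub0r.
apply: le_trans (ler_norm _) _; apply: le_trans (ler_normB _ _) _; lra.
Qed.

End OneDimensional.

Lemma exists_trunc (R : realType) (c e : R) : 0 <= c -> 0 < e ->
  exists2 K : nat, (0 < K)%N & (K%:R + 2) * c <= e * 2 ^+ K.
Proof.
move=> c0 e0; pose n := (Num.truncn (2 * c / e)).+1.
(* One factor 2^n absorbs n + 1, the other absorbs 2c/e. *)
exists (n + n)%N; first by rewrite addn_gt0.
have hn : 2 * c / e <= n%:R by apply/ltW/truncnS_gt.
have h2n : (n%:R + 1) <= 2 ^+ n :> R.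
  by rewrite -natrX natr1 ler_nat ltn_expl.
rewrite exprD natrD.
have h1 : 2 * c <= e * n%:R by rewrite [leRHS]mulrC -ler_pdivrMr.
have h2 : (n%:R + 1) * (2 * c) <= (n%:R + 1) * (e * 2 ^+ n).
  rewrite ler_wpM2l ?addr_ge0 //; apply: le_trans h1 _; rewrite ler_wpM2l ?(ltW e0) //; lra.
have h3 : (n%:R + 1) * (e * 2 ^+ n) <= 2 ^+ n * (e * 2 ^+ n).
  by rewrite ler_wpM2r // mulr_ge0 ?(ltW e0) // exprn_ge0.
lra.
Qed.

Lemma tv_eps_le (R : realType) (K : nat) (om : bool) (T : seq nat) :
  (forall p, p \in T -> prime p) -> T != [::] ->
  tv_eps R K om T * 2 ^+ K <=
  (K%:R + 2) * (((set_lam R om T * pois_pmf (set_lam R om T) 0)^-1 + 1) * (size T)%:R).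
Proof.
move=> HT T0; rewrite /tv_eps; have l0 := @set_lam_gt0 R om T HT T0.
set G := (_ + 1 : R).
have G0 : 0 <= G.
  by rewrite addr_ge0 // invr_ge0 mulr_ge0 ?(ltW l0) // ltW // pois_pmf_gt0.
have -> : G * (K%:R + 2) * (\sum_(p <- T) p%:R^-1 ^+ K) * 2 ^+ K =
  (K%:R + 2) * (G * ((\sum_(p <- T) p%:R^-1 ^+ K) * 2 ^+ K)) by ring.
rewrite ler_wpM2l ?addr_ge0 // ler_wpM2l // mulr_suml.
apply: le_trans (_ : \sum_(p <- T) 1 <= _); last first.
  by rewrite big_const_seq count_predT iter_addr addr0.
rewrite !big_seq; apply: ler_sum => p /HT /(inv_prime_le_half R) h.
rewrite -exprMn exprn_ile1 //; lra.
Qed.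

Section ProductModel.
Variables (R : realType) (K m : nat) (T : 'I_m -> seq nat) (om : 'I_m -> bool).
Hypothesis HT : forall i p, p \in T i -> prime p.
Hypothesis uT : forall i, uniq (T i).
Hypothesis dT : forall i j p, i != j -> p \in T i -> p \notin T j.

Lemma big_smooth_nums_cat (V : nmodType) (l1 l2 : seq nat) (F : nat -> V) :
  \sum_(a <- smooth_nums K (l1 ++ l2)) F a =
  \sum_(a <- smooth_nums K l1) \sum_(b <- smooth_nums K l2) F (a * b)%N.
Proof.
elim: l1 F => [|p l1 IH] F; first by rewrite /= big_seq1; apply: eq_bigr => b _; rewrite mul1n.
rewrite cat_cons !big_smooth_nums; apply: eq_bigr => k _; rewrite IH.
by apply: eq_bigr => a _; apply: eq_bigr => b _; rewrite mulnA.
Qed.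

Definition fcount (i : 'I_m) (n : nat) : nat :=
  (\sum_(p <- T i) pcount (om i) (logn p n))%N.

Definition unionT (r : seq 'I_m) : seq nat := flatten [seq T i | i <- r].

Lemma unionT_prime r p : p \in unionT r -> prime p.
Proof. by case/flatten_mapP => i _ /HT. Qed.

Lemma unionT_uniq r : uniq r -> uniq (unionT r).
Proof.
elim: r => //= i r IH /andP[ir ur]; rewrite cat_uniq uT IH // andbT.
apply/hasPn => p /flatten_mapP[j jr pj]; apply: (dT _ pj).
by apply: contraNneq ir => <-.
Qed.

Lemma product_model r (h : 'I_m -> nat -> R) : uniq r ->
  euler_prod R (unionT r) * \sum_(a <- smooth_nums K (unionT r)) (\prod_(i <- r) h i (fcount i a)) / a%:R =
  \prod_(i <- r) @model_expect R K (om i) (T i) (h i).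
Proof.
elim: r => [|i r IH].
  by move=> _; rewrite /euler_prod /unionT /= !big_nil mul1r big_seq1 big_nil divr1.
rewrite cons_uniq => /andP[ir ur].
have -> : unionT (i :: r) = T i ++ unionT r by [].
rewrite big_cons -IH // -(smooth_nums_model_expect _ _ _ (uT i) (@HT i)) big_smooth_nums_cat.
rewrite /euler_prod big_cat /= -/(euler_prod R (T i)) -/(euler_prod R (unionT r)).
rewrite mulrACA; congr (_ * _); rewrite mulr_suml big_seq [RHS]big_seq; apply: eq_bigr => a ha.
rewrite mulr_sumr big_seq [RHS]big_seq; apply: eq_bigr => b hb.
have a0 : (0 < a)%N by apply: smooth_nums_gt0 ha; exact: HT.
have b0 : (0 < b)%N by apply: smooth_nums_gt0 hb; exact: unionT_prime.
have -> : \prod_(i0 <- i :: r) h i0 (fcount i0 (a * b)) =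
   h i (fcount i a) * \prod_(j <- r) h j (fcount j b).
  rewrite big_cons; congr (_ * _).
    congr (h _ _); rewrite /fcount big_seq [RHS]big_seq; apply: eq_bigr => p pi.
    rewrite lognM // (@smooth_nums_logn0 K (unionT r) b p) ?addn0 //.
    - exact: unionT_prime.
    - exact: HT pi.
    - apply/negP => /flatten_mapP[j jr pj]; move: pj; apply/negP.
      apply: (dT _ pi); by apply: contraNneq ir => ->.
  rewrite !big_seq; apply: eq_bigr => j jr.
  congr (h _ _); rewrite /fcount big_seq [RHS]big_seq; apply: eq_bigr => p pj.
  rewrite lognM // (@smooth_nums_logn0 K (T i) a p) ?add0n //.
  - exact: HT.
  - exact: HT pj.
  - apply: (dT _ pj); by apply: contraNneq ir => <-.
by rewrite natrM invfM mulrACA.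
Qed.

End ProductModel.

(** * Total variation distance of the vectors *)

Section PoissonVector.
Variables (R : realType) (m : nat) (lam : 'I_m -> R).
Hypothesis l0 : forall i, 0 < lam i.

Definition pois_vec_pmf (k : {ffun 'I_m -> nat}) : R := \prod_(i < m) pois_pmf (lam i) (k i).

Definition embed_box (M : nat) (k : {ffun 'I_m -> 'I_M}) : {ffun 'I_m -> nat} :=
  [ffun i => val (k i)].

Lemma embed_box_inj M : injective (@embed_box M).
Proof.
move=> k k' /ffunP e; apply/ffunP => i; apply: val_inj.
by have := e i; rewrite !ffunE.
Qed.

Lemma pois_vec_pmf_ge0 k : 0 <= pois_vec_pmf k.
Proof. by apply: prodr_ge0 => i _; rewrite ltW // pois_pmf_gt0. Qed.

Lemma pois_vec_box_sum M :
  \sum_(k : {ffun 'I_m -> 'I_M}) pois_vec_pmf (embed_box k) = \prod_(i < m) pois_cdf (lam i) M.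
Proof.
rewrite /pois_cdf bigA_distr_bigA /=; apply: eq_bigr => k _.
by apply: eq_bigr => i _; rewrite ffunE.
Qed.

Lemma pois_vec_box_le1 M : \sum_(k : {ffun 'I_m -> 'I_M}) pois_vec_pmf (embed_box k) <= 1.
Proof.
rewrite pois_vec_box_sum; apply: prodr_ile1 => i _.
rewrite pois_cdf_le1 // andbT; apply: sumr_ge0 => j _.
by rewrite ltW // pois_pmf_gt0.
Qed.

Lemma pois_vec_seq_le1 (s : seq {ffun 'I_m -> nat}) : uniq s -> \sum_(x <- s) pois_vec_pmf x <= 1.
Proof.
move=> us; pose M := (\max_(x <- s) \max_(i < m) x i)%N.
have hM x i : x \in s -> (x i < M.+1)%N.
  move=> xs; rewrite ltnS; apply: leq_trans (_ : \max_(i < m) x i <= _)%N.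
    exact: (leq_bigmax i).
  exact: (leq_bigmax_seq x).
pose g (x : {ffun 'I_m -> nat}) : {ffun 'I_m -> 'I_M.+1} := [ffun i => inord (x i)].
have gK x : x \in s -> embed_box (g x) = x.
  by move=> xs; apply/ffunP => i; rewrite !ffunE /= inordK // hM.
have -> : \sum_(x <- s) pois_vec_pmf x = \sum_(k <- map g s) pois_vec_pmf (embed_box k).
  by rewrite big_map !big_seq; apply: eq_bigr => x xs; rewrite gK.
apply: le_trans (pois_vec_box_le1 M.+1).
rewrite big_uniq /=; last first.
  rewrite map_inj_in_uniq // => x y xs ys e.
  by rewrite -(gK x xs) -(gK y ys) e.
rewrite [leLHS]big_mkcond /=; apply: ler_sum => k _.
by case: ifP => _ //; exact: pois_vec_pmf_ge0.
Qed.

Lemma pois_vec_lower (A : set {ffun 'I_m -> nat}) s : uniq s ->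
  (forall x, x \in s -> A x) ->
  ((\sum_(x <- s) pois_vec_pmf x)%:E <= pois_vec_prob lam A)%E.
Proof.
move=> us sA; apply: esum_ge; exists [set` s]%classic.
  by split; [exact: finite_seq|move=> x /= /sA].
by rewrite -fsbig_seq // sumEFin.
Qed.

(** A finite part of [A] is disjoint from [s], and together they have mass at most 1. *)
Lemma pois_vec_upper (A : set {ffun 'I_m -> nat}) s : uniq s ->
  (forall x, x \in s -> ~ A x) ->
  (pois_vec_prob lam A <= (1 - \sum_(x <- s) pois_vec_pmf x)%:E)%E.
Proof.
move=> us sA; apply: ge_ereal_sup => _ /= [X [finX XA] <-].
rewrite fsbig_finite //= sumEFin lee_fin lerBrDr -big_cat /=.
apply: pois_vec_seq_le1; rewrite cat_uniq us andbT finmap.fset_uniq /=.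
apply/hasPn => x xs; apply/negP => /=; rewrite in_fset_set // inE.
by move=> /XA; exact: sA.
Qed.

Lemma PxE (x : R) (E : nat -> Prop) :
  Px x E = (\sum_(k < Num.truncn x) (`[< E k.+1 >])%:R) / (Num.truncn x)%:R.
Proof.
rewrite /Px -sum1_card big_mkcond /= natr_sum; congr (_ / _).
apply: eq_bigr => k _.
suff -> : (k \in [set k : 'I_(Num.truncn x) | `[< E k.+1 >]]%classic) = `[< E k.+1 >].
  by case: asbool.
by apply/idP/idP; rewrite in_setE.
Qed.

(* A one-sided comparison of the point masses on a box of Poisson mass at least [1 - e]
   suffices, since it can be applied to an event and to its complement. *)
Lemma dtv_le (x : R) (f : nat -> {ffun 'I_m -> nat}) M
    (d : {ffun 'I_m -> 'I_M} -> R) (D e : R) :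
  (0 < Num.truncn x)%N -> (forall k, 0 <= d k) ->
  (forall k, pois_vec_pmf (embed_box k) - Px x (fun n => f n = embed_box k) <= d k) ->
  \sum_k d k <= D -> 1 - \prod_(i < m) pois_cdf (lam i) M <= e ->
  (dTV_unif_pois x f lam <= (D + e)%:E)%E.
Proof.
move=> N0 d0 hd hD he; set N := Num.truncn x.
have N0' : 0 < N%:R :> R by rewrite ltr0n.
have hbox := pois_vec_box_sum M.
pose SA (A : set {ffun 'I_m -> nat}) := \sum_(k : {ffun 'I_m -> 'I_M} | `[< A (embed_box k) >]) pois_vec_pmf (embed_box k).
have lowP A : SA A - D <= Px x (fun n => A (f n)).
  apply: le_trans (_ : \sum_(k : {ffun 'I_m -> 'I_M} | `[< A (embed_box k) >]) Px x (fun n => f n = embed_box k) <= _).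
    apply: le_trans (_ : \sum_(k : {ffun 'I_m -> 'I_M} | `[< A (embed_box k) >]) (pois_vec_pmf (embed_box k) - d k) <= _).
      rewrite sumrB lerD2l lerN2; apply: le_trans hD.
      by rewrite [leLHS]big_mkcond /=; apply: ler_sum => k _; case: ifP.
    by apply: ler_sum => k _; have := hd k; lra.
  under eq_bigr do rewrite PxE.
  rewrite -mulr_suml PxE ler_wpM2r ?invr_ge0 ?ler0n // exchange_big /=.
  apply: ler_sum => n _.
  case: asboolP => hA; last first.
    rewrite big1 // => k /asboolP hk; case: asboolP => // e'.
    by move: hA; rewrite e'.
  case: (pickP (fun k : {ffun 'I_m -> 'I_M} => `[< f n.+1 = embed_box k >])) => [k0 hk0|hn].
    rewrite big_mkcond (bigD1 k0) //= big1 ?addr0.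
      by case: ifP => // _; case: asboolP.
    move=> k kk; case: ifP => // _; case: asboolP => // e'.
    move: hk0 => /asboolP; rewrite e' => /embed_box_inj e2.
    by move: kk; rewrite e2 eqxx.
  by rewrite big1 // => k _; rewrite hn.
have PC A : Px x (fun n => A (f n)) + Px x (fun n => ~ A (f n)) = 1.
  rewrite !PxE -mulrDl -big_split /=.
  have -> : \sum_(i < N) ((`[< A (f i.+1) >])%:R + (`[< ~ A (f i.+1) >])%:R) = N%:R :> R.
    rewrite -[in RHS](card_ord N) -sum1_card natr_sum; apply: eq_bigr => i _.
    by rewrite asbool_neg; case: asboolP => _; rewrite /= ?addr0 ?add0r.
  by rewrite divff // gt_eqF.
have seqE A : exists s : seq {ffun 'I_m -> nat},
    [/\ uniq s, forall y, y \in s -> A y & \sum_(y <- s) pois_vec_pmf y = SA A].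
  exists [seq embed_box k | k <- enum {ffun 'I_m -> 'I_M} & `[< A (embed_box k) >]]; split.
  - by rewrite map_inj_uniq; [exact/filter_uniq/enum_uniq|exact: embed_box_inj].
  - by move=> y /mapP[k]; rewrite mem_filter => /andP[/asboolP h _] ->.
  - by rewrite big_map big_filter big_enum_cond.
apply: ge_ereal_sup => _ /= [A _ <-].
have [s [us sA eA]] := seqE A.
have [s' [us' sA' eA']] := seqE (fun y => ~ A y).
have low := pois_vec_lower us sA; have up := pois_vec_upper us' sA'.
rewrite eA in low; rewrite eA' in up.
have SAC : SA A + SA (fun y => ~ A y) = \prod_(i < m) pois_cdf (lam i) M.
  rewrite -hbox /SA [RHS](bigID (fun k : {ffun 'I_m -> 'I_M} => `[< A (embed_box k) >])) /=.
  by congr (_ + _); apply: eq_bigl => k; rewrite asbool_neg.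
have := lowP A; have := lowP (fun y => ~ A y); have := PC A.
have fin : pois_vec_prob lam A \is a fin_num.
  by rewrite fin_numE -ltNye -ltey (lt_le_trans _ low) ?ltNyr //= (le_lt_trans up) ?ltry.
move: low up; rewrite -(fineK fin); set r := fine _; rewrite !lee_fin.
move=> low up pc l1 l2; rewrite ler_norml; lra.
Qed.

End PoissonVector.

(** * From sifted counts to the law of the vector *)

Section KubiliusCount.
Variables (R : realType) (K m : nat) (T : 'I_m -> seq nat) (om : 'I_m -> bool).
Hypothesis HT : forall i p, p \in T i -> prime p.
Hypothesis uT : forall i, uniq (T i).
Hypothesis dT : forall i j p, i != j -> p \in T i -> p \notin T j.

Local Notation S := (unionT T (enum 'I_m)).

Lemma logn_match (n a q : nat) : (0 < n)%N -> (0 < a)%N -> prime q ->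
  (a %| n)%N -> ~~ (a * q %| n)%N -> logn q n = logn q a.
Proof.
move=> n0 a0 pq /dvdnP[b e]; rewrite e [(b * a)%N]mulnC dvdn_pmul2l // => qb.
have b0 : (0 < b)%N by move: n0; rewrite e muln_gt0 => /andP[].
rewrite lognM //; suff -> : logn q b = 0%N by rewrite addn0.
by apply/eqP; rewrite -leqn0 leqNgt logn_gt0 mem_primes pq b0.
Qed.

Lemma fcountE n i : (0 < n)%N ->
  (if om i then OmegaT n (T i) else omegaT n (T i)) = fcount T om i n.
Proof.
move=> n0; rewrite /OmegaT /omegaT /fcount /pcount; case: (om i) => //.
rewrite -sum1_count big_mkcond /= !big_seq; apply: eq_bigr => p /HT pp.
by rewrite logn_gt0 mem_primes pp n0 /=; case: (p %| n)%N.
Qed.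

Definition fvec (n : nat) : {ffun 'I_m -> nat} := [ffun i => fcount T om i n].

Lemma count_le1 (s : seq nat) (P : pred nat) : uniq s ->
  (forall a b, a \in s -> b \in s -> P a -> P b -> a = b) -> (count P s <= 1)%N.
Proof.
move=> us H; rewrite -size_filter.
case e : (seq.filter P s) => [//|a l].
have : a \in seq.filter P s by rewrite e mem_head.
rewrite mem_filter => /andP[Pa as'].
rewrite -e -[leqRHS]/(size [:: a]); apply: uniq_leq_size; first exact: filter_uniq.
by move=> b; rewrite mem_filter inE => /andP[Pb bs]; apply/eqP/H.
Qed.

(** An n has only one S-part, so different [a] count disjoint sets of n, and the S-part determines
    the vector. Only an inequality: an n with an exponent [K] or more is missed. *)
Lemma sieve_count_sum_le N ps (kk : {ffun 'I_m -> nat}) : perm_eq S ps ->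
  (\sum_(a <- smooth_nums K S | fvec a == kk) sieve_count N a 1 ps <=
   \sum_(1 <= n < N.+1) (fvec n == kk))%N.
Proof.
move=> pS; rewrite /sieve_count exchange_big /= !big_nat; apply: leq_sum => n /andP[n0 _].
have pr : forall p, p \in S -> prime p by exact: (unionT_prime HT).
have uS : uniq S by apply: unionT_uniq => //; exact: enum_uniq.
pose mt a := (a * 1 %| n)%N && all (fun q => ~~ (a * q %| n)%N) ps.
have mtP a : a \in smooth_nums K S -> mt a -> forall p, p \in S -> logn p n = logn p a.
  move=> ha /andP[]; rewrite muln1 => an /allP h p pS'.
  apply: logn_match => //; [exact: smooth_nums_gt0 ha|exact: pr|].
  by apply: h; rewrite -(perm_mem pS).
have mtf a : a \in smooth_nums K S -> mt a -> fvec n = fvec a.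
  move=> ha hm; apply/ffunP => i; rewrite !ffunE /fcount big_seq [RHS]big_seq.
  apply: eq_bigr => p pi; rewrite (mtP a) //.
  by apply/flatten_mapP; exists i; rewrite ?mem_enum.
case: eqP => hk.
  apply: leq_trans (_ : count mt (smooth_nums K S) <= _)%N; last first.
    apply: count_le1; first exact: smooth_nums_uniq.
    move=> a b ha hb ma mb; rewrite (smooth_nums_prod uS pr ha) (smooth_nums_prod uS pr hb).
    rewrite big_seq [RHS]big_seq; apply: eq_bigr => p pS'.
    by rewrite -(mtP a) // -(mtP b).
  rewrite -sum1_count [leqLHS]big_mkcond [leqRHS]big_mkcond /=; apply: leq_sum => a _.
  by rewrite -/(mt a); case: eqP; case: (mt a).
rewrite big_seq_cond big1 // => a /andP[ha /eqP fa].
rewrite -/(mt a); case hm : (mt a) => //.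
by case: hk; rewrite (mtf a).
Qed.

Lemma Px_lower (x : R) ps (kk : {ffun 'I_m -> nat}) :
  perm_eq S ps ->
  \sum_(a <- smooth_nums K S | fvec a == kk) (sieve_count (Num.truncn x) a 1 ps)%:R / (Num.truncn x)%:R <=
  Px x (fun n => [ffun i => if om i then OmegaT n (T i) else omegaT n (T i)] = kk).
Proof.
move=> pS; rewrite PxE -mulr_suml ler_wpM2r ?invr_ge0 ?ler0n // -natr_sum.
apply: le_trans (_ : (\sum_(1 <= n < (Num.truncn x).+1) (fvec n == kk))%:R <= _).
  by rewrite ler_nat; exact: sieve_count_sum_le.
rewrite big_add1 /= big_mkord natr_sum; apply: ler_sum => n _.
rewrite ler_nat; case: eqP => // hk; case: asboolP => //; case.
by rewrite -hk; apply/ffunP => i; rewrite !ffunE fcountE.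
Qed.

Lemma model_joint_pmf (kk : {ffun 'I_m -> nat}) :
  euler_prod R S * \sum_(a <- smooth_nums K S | fvec a == kk) (a%:R)^-1 =
  \prod_(i < m) model_pmf R K (om i) (T i) (kk i).
Proof.
have := @product_model R K m T om HT uT dT (enum 'I_m)
  (fun i w => (w == kk i)%:R) (enum_uniq _).
rewrite [in RHS]big_enum /= /model_pmf => <-; congr (_ * _).
rewrite big_mkcond /=; apply: eq_bigr => a _; rewrite big_enum /=.
case: eqP => [e|ne].
  by rewrite big1 ?mul1r // => i _; rewrite -e ffunE eqxx.
have /existsP[i hi] : [exists i, fvec a i != kk i].
  apply: contra_notT ne; rewrite negb_exists => /forallP h.
  by apply/ffunP => i; have := h i; rewrite negbK => /eqP.
rewrite (bigD1 i) //=; move: hi; rewrite ffunE => /negbTE ->.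
by rewrite !mul0r.
Qed.

End KubiliusCount.

(** Hybrid argument: coordinates are exchanged one at a time, and the others sum to at most 1.
    Masses below 1 are allowed, as the model is truncated. *)
Lemma prod_diff_le (R : realType) (m M : nat) (a b : 'I_m -> nat -> R) :
  (forall i k, 0 <= a i k) -> (forall i k, 0 <= b i k) ->
  (forall i, \sum_(k < M) a i k <= 1) -> (forall i, \sum_(k < M) b i k <= 1) ->
  \sum_(k : {ffun 'I_m -> 'I_M}) `|\prod_(i < m) a i (k i) - \prod_(i < m) b i (k i)|
  <= \sum_(i < m) \sum_(k < M) `|a i k - b i k|.
Proof.
move=> a0 b0 a1 b1.
pose c (j : 'I_m) (i : 'I_m) (k : nat) : R :=
  if (i < j)%N then b i k else if i == j then `|a i k - b i k| else a i k.
have tele (k : {ffun 'I_m -> 'I_M}) :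
   `|\prod_(i < m) a i (k i) - \prod_(i < m) b i (k i)| <= \sum_(j < m) \prod_(i < m) c j i (k i).
  clear a1 b1; elim: m a b a0 b0 @c k => [|n IH] a b a0 b0 c k.
    by rewrite !big_ord0 subrr normr0.
  rewrite [X in `|X - _|]big_ord_recl [X in `|_ - X|]big_ord_recl.
  set A := \prod_(i < n) _; set B := \prod_(i < n) b _ _.
  have A0 : 0 <= A by apply: prodr_ge0.
  have -> : a ord0 (k ord0) * A - b ord0 (k ord0) * B =
    (a ord0 (k ord0) - b ord0 (k ord0)) * A + b ord0 (k ord0) * (A - B) by ring.
  apply: le_trans (ler_normD _ _) _; rewrite big_ord_recl; apply: lerD.
    rewrite normrM (ger0_norm A0) big_ord_recl /c /= ler_wpM2l //.
  rewrite normrM (ger0_norm (b0 _ _)).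
  pose k' : {ffun 'I_n -> 'I_M} := [ffun i => k (lift ord0 i)].
  have := IH (fun i => a (lift ord0 i)) (fun i => b (lift ord0 i))
     (fun i => a0 _) (fun i => b0 _) k'.
  have -> : \prod_(i < n) a (lift ord0 i) (k' i) = A by apply: eq_bigr => i _; rewrite ffunE.
  have -> : \prod_(i < n) b (lift ord0 i) (k' i) = B by apply: eq_bigr => i _; rewrite ffunE.
  move=> h; apply: le_trans (ler_wpM2l (b0 _ _) h) _; rewrite mulr_sumr.
  apply: ler_sum => j _; rewrite big_ord_recl /= ler_wpM2l //.
  rewrite le_eqVlt; apply/orP; left; apply/eqP; apply: eq_bigr => i _.
  by rewrite /c ffunE /= /bump /= !add1n ltnS (inj_eq lift_inj).
apply: le_trans (ler_sum _ (fun k _ => tele k)) _.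
rewrite exchange_big /=; apply: ler_sum => j _.
have := bigA_distr_bigA (fun i (k : 'I_M) => c j i k); rewrite /= => <-.
rewrite (bigD1 j) //=.
rewrite (eq_bigr (fun k : 'I_M => `|a j k - b j k|)); last by move=> k _; rewrite /c ltnn eqxx.
rewrite ler_piMr ?sumr_ge0 //; apply: prodr_ile1 => i ij.
rewrite /c; case: ltnP => _; rewrite ?(negbTE ij).
  by rewrite b1 andbT sumr_ge0.
by rewrite a1 andbT sumr_ge0.
Qed.

Lemma sum_fiber_le (R : realType) (m M : nat) (s : seq nat)
    (F : nat -> {ffun 'I_m -> nat}) (w : nat -> R) : (forall a, 0 <= w a) ->
  \sum_(k : {ffun 'I_m -> 'I_M}) \sum_(a <- s | F a == embed_box k) w a <= \sum_(a <- s) w a.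
Proof.
move=> w0; under eq_bigr do rewrite big_mkcond.
rewrite exchange_big /=; apply: ler_sum => a _; rewrite -big_mkcond /=.
case: (pickP (fun k : {ffun 'I_m -> 'I_M} => F a == embed_box k)) => [k0 /eqP h|h].
  by rewrite (big_pred1 k0) // => k; rewrite h (inj_eq (@embed_box_inj m M)) eq_sym.
by rewrite big_pred0.
Qed.

Lemma one_sub_prod_le (R : realType) (I : Type) (r : seq I) (F : I -> R) :
  (forall i, 0 <= F i <= 1) -> 1 - \prod_(i <- r) F i <= \sum_(i <- r) (1 - F i).
Proof.
move=> F01; have P01 : 0 <= \prod_(i <- r) F i <= 1.
  by rewrite prodr_ge0 /= ?prodr_ile1 // => i _; have /andP[] := F01 i.
elim: r P01 => [|i r IH] _; first by rewrite !big_nil subrr.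
have P01 : 0 <= \prod_(i <- r) F i <= 1.
  by rewrite prodr_ge0 /= ?prodr_ile1 // => j _; have /andP[] := F01 j.
have := IH P01; rewrite !big_cons; have /andP[f0 f1] := F01 i.
have /andP[p0 p1] := P01.
have : (1 - F i) * (1 - \prod_(i <- r) F i) >= 0 by rewrite mulr_ge0 // subr_ge0.
lra.
Qed.

(** * Combination of the two approximations *)

Section Assembly.
Variables (R : realType) (m : nat) (T : 'I_m -> seq nat) (om : 'I_m -> bool).
Hypothesis HT : forall i p, p \in T i -> prime p.
Hypothesis uT : forall i, uniq (T i).
Hypothesis dT : forall i j p, i != j -> p \in T i -> p \notin T j.
Hypothesis nT : forall i, T i != [::].

Local Notation S := (unionT T (enum 'I_m)).
Local Notation lam := (fun i => set_lam R (om i) (T i)).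
Local Notation f := (fun n => [ffun i => if om i then OmegaT n (T i) else omegaT n (T i)]).

Let l0 i : 0 < lam i. Proof. by apply: set_lam_gt0 => //; exact: HT. Qed.

(** [K] and [M] are chosen last, depending on all the data; truncating exponents costs one [eta] and
    the box another. The 80 is twice the 40 of [tv_bound]. *)
Lemma dtv_kubilius (x u L s : R) (kap : nat) (eta : R) :
  (forall p, p \in S -> (lg p <= kap)%N) ->
  1 <= L -> 16 * L <= kap%:R -> s * kap%:R = L ->
  1 <= x -> expR (ln 2 * (u * kap%:R)) <= x -> 0 < eta ->
  (dTV_unif_pois x f lam <=
   (80 * \sum_(j < m) Hs'' R (T j) / (1 + Hs R (T j)) + 2 * eta +
    (2 * expR (- (L * u) + 77 * L + 9 + 5 * rankin_bound L + 64 * expR (L / 2)) +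
     2 * expR (- (10 * ln 2 * kap%:R))))%:E)%E.
Proof.
move=> lk L1 Lk sk x1 ux eta0.
have N0 : (0 < Num.truncn x)%N by rewrite truncn_gt0.
have xN : x <= 2 * (Num.truncn x)%:R.
  have : x < (Num.truncn x).+1%:R by apply: truncnS_gt.
  have : 1 <= (Num.truncn x)%:R :> R by rewrite ler1n.
  rewrite -[(Num.truncn x).+1%:R]natr1; lra.
have pr p : p \in S -> prime p by exact: (unionT_prime HT).
have uS : uniq S by apply: unionT_uniq => //; exact: enum_uniq.
have HS p : p \in S -> prime p /\ (lg p <= kap)%N by move=> h; split; [exact: pr|exact: lk].
pose ps := sort geq S.
have pS : perm_eq S ps by rewrite perm_sym perm_sort.
have sps : sorted gtn ps.
  rewrite gtn_sorted_uniq_geq sort_uniq uS /=; apply: sort_sorted.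
  by move=> a b; rewrite /geq /= leq_total.
pose c i : R := ((lam i * pois_pmf (lam i) 0)^-1 + 1) * (size (T i))%:R.
have c0 i : 0 <= c i.
  rewrite mulr_ge0 // addr_ge0 // invr_ge0 mulr_ge0 ?(ltW (l0 i)) //.
  by rewrite ltW // pois_pmf_gt0.
have e20 : 0 < eta / 2 by lra.
have sc0 : 0 <= \sum_(i < m) c i by apply: sumr_ge0.
have [K K0 hK] := exists_trunc sc0 e20.
have eps_le : \sum_(i < m) tv_eps R K (om i) (T i) <= eta / 2.
  have p2 : 0 < 2 ^+ K :> R by rewrite exprn_gt0.
  rewrite -(ler_pM2r p2); apply: le_trans hK; rewrite mulr_suml mulr_sumr.
  apply: ler_sum => i _; apply: tv_eps_le => //; exact: HT.
have em : 0 < eta / (m%:R + 1) by rewrite divr_gt0 // ltr_wpDl.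
have /fin_all_exists[n0 hn0] : forall i : 'I_m, exists n0, forall n, (n0 <= n)%N ->
    1 - pois_cdf (lam i) n <= eta / (m%:R + 1).
  by move=> i; apply: pois_cdf_near1.
pose M := (\max_(i < m) n0 i)%N.
have hbox : 1 - \prod_(i < m) pois_cdf (lam i) M <= eta.
  apply: le_trans (one_sub_prod_le _ _) _.
    move=> i; rewrite pois_cdf_le1 // andbT; apply: sumr_ge0 => j _.
    by rewrite ltW // pois_pmf_gt0.
  apply: le_trans (_ : \sum_(i < m) eta / (m%:R + 1) <= _).
    by apply: ler_sum => i _; apply: hn0; exact: (leq_bigmax i).
  rewrite sumr_const card_ord -[leLHS]mulr_natr mulrAC ler_pdivrMr ?ltr_wpDl //.
  by rewrite ler_wpM2l ?(ltW eta0) // lerDl.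
pose mu (kk : {ffun 'I_m -> nat}) : R := \prod_(i < m) model_pmf R K (om i) (T i) (kk i).
pose err := kubilius_err S kap L s u.
have err0 a : 0 <= err a by apply: (kubilius_err_ge0 HS).
(* First the distance from model to Poisson, then the sieve errors of all [a] with the given
   vector. *)
pose d (k : {ffun 'I_m -> 'I_M}) : R := `|mu (embed_box k) - pois_vec_pmf lam (embed_box k)| +
   \sum_(a <- smooth_nums K S | fvec T om a == embed_box k) err a.
have hsum : \sum_k d k <= 80 * (\sum_(j < m) Hs'' R (T j) / (1 + Hs R (T j))) + eta +
    (2 * expR (- (L * u) + 77 * L + 9 + 5 * rankin_bound L + 64 * expR (L / 2)) +
     2 * expR (- (10 * ln 2 * kap%:R))).
  rewrite /d big_split /=; apply: lerD; last first.
    by apply: le_trans (sum_fiber_le _ _ _ err0) (kubilius_err_sum _ uS HS L1 Lk sk u).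
  apply: le_trans (_ : \sum_(i < m) \sum_(k < M) `|model_pmf R K (om i) (T i) k - pois_pmf (lam i) k| <= _).
    rewrite (eq_bigr (fun k : {ffun 'I_m -> 'I_M} => `|\prod_(i < m) model_pmf R K (om i) (T i) (k i)
       - \prod_(i < m) pois_pmf (lam i) (k i)|)); last first.
      move=> k _; congr `|_ - _|; apply: eq_bigr => i _; by rewrite ffunE.
    apply: (@prod_diff_le R m M (fun i => model_pmf R K (om i) (T i)) (fun i => pois_pmf (lam i))).
    - by move=> i k; apply: model_pmf_ge0; exact: HT.
    - by move=> i k; rewrite ltW // pois_pmf_gt0.
    - by move=> i; apply: model_pmf_sum_le1; exact: HT.
    - by move=> i; apply: pois_cdf_le1.
  apply: le_trans (_ : \sum_(i < m) 2 * tv_bound R K (om i) (T i) <= _).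
    by apply: ler_sum => i _; apply: model_pois_l1 => //; exact: HT.
  rewrite -mulr_sumr /tv_bound big_split /= -mulr_sumr.
  move: eps_le; lra.
have := @dtv_le R m lam l0 x f M d _ eta N0 _ _ hsum hbox.
have -> : 80 * (\sum_(j < m) Hs'' R (T j) / (1 + Hs R (T j))) + eta +
    (2 * expR (- (L * u) + 77 * L + 9 + 5 * rankin_bound L + 64 * expR (L / 2)) +
     2 * expR (- (10 * ln 2 * kap%:R))) + eta =
  80 * (\sum_(j < m) Hs'' R (T j) / (1 + Hs R (T j))) + 2 * eta +
    (2 * expR (- (L * u) + 77 * L + 9 + 5 * rankin_bound L + 64 * expR (L / 2)) +
     2 * expR (- (10 * ln 2 * kap%:R))) by ring.
apply.
  by move=> k; rewrite /d addr_ge0 // sumr_ge0.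
move=> k; have hp := @Px_lower R K m T om HT uT dT x ps (embed_box k) pS.
have hm : mu (embed_box k) = \sum_(a <- smooth_nums K S | fvec T om a == embed_box k) euler_prod R S / a%:R.
  by rewrite /mu -(model_joint_pmf R K om HT uT dT) mulr_sumr.
have hk : \sum_(a <- smooth_nums K S | fvec T om a == embed_box k) euler_prod R S / a%:R -
    \sum_(a <- smooth_nums K S | fvec T om a == embed_box k)
       (sieve_count (Num.truncn x) a 1 ps)%:R / (Num.truncn x)%:R <=
    \sum_(a <- smooth_nums K S | fvec T om a == embed_box k) err a.
  rewrite -sumrB big_seq_cond [leRHS]big_seq_cond; apply: ler_sum => a /andP[ha _].
  exact: (kubilius_pointwise uS HS pS sps L1 Lk sk N0 xN ux ha).
have := ler_norm (- (mu (embed_box k) - pois_vec_pmf lam (embed_box k))); rewrite normrN.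
rewrite /d; move: hp hk; rewrite -hm; lra.
Qed.

(** With the Poisson masses themselves as pointwise errors, the two terms of [dtv_le] add up to 1
    whatever the box. *)
Lemma dtv_le1 (x : R) : 1 <= x -> (dTV_unif_pois x f lam <= 1%:E)%E.
Proof.
move=> x1; have N0 : (0 < Num.truncn x)%N by rewrite truncn_gt0.
have h := @dtv_le R m lam l0 x f 0 (fun k => pois_vec_pmf lam (embed_box k)) _ _ N0 _ _ (lexx _) (lexx _).
have := h; rewrite pois_vec_box_sum addrCA subrr addr0; apply.
  by move=> k; exact: pois_vec_pmf_ge0.
by move=> k; rewrite lerBlDr lerDl /Px divr_ge0 ?ler0n.
Qed.

(** Makes negative powers of y absorbable. A single prime p <= 2^(2 kap) gives H'' >= 2^(-4 kap),
    and 1 + H <= 1 + 2 kap <= 2^(2 kap). *)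
Lemma Hs''_sum_lower (kap : nat) (i : 'I_m) :
  (forall p, p \in S -> (lg p <= kap)%N) -> (0 < kap)%N ->
  expR (- (6 * ln 2 * kap%:R)) <= \sum_(j < m) Hs'' R (T j) / (1 + Hs R (T j)).
Proof.
move=> lk k0.
have H0 j : 0 <= Hs'' R (T j).
  by apply: sumr_ge0 => p _; rewrite invr_ge0 exprn_ge0.
have H1 j : 0 < Hs R (T j) by apply: Hs_gt0 => //; exact: HT.
rewrite (bigD1 i) //=.
have h0 : 0 <= \sum_(j < m | j != i) Hs'' R (T j) / (1 + Hs R (T j)).
  by apply: sumr_ge0 => j _; rewrite divr_ge0 // addr_ge0 // ltW.
suff : expR (- (6 * ln 2 * kap%:R)) <= Hs'' R (T i) / (1 + Hs R (T i)) by lra.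
have HSi p : p \in T i -> prime p /\ (lg p <= kap)%N.
  move=> h; split; first exact: HT h.
  by apply: lk; apply/flatten_mapP; exists i; rewrite ?mem_enum.
have hs : Hs R (T i) <= 2 * kap%:R := sum_inv_le R (uT i) HSi.
have e2 (t : nat) : expR (- (t%:R * ln 2 * kap%:R)) = ((2 ^ (t * kap))%:R)^-1 :> R.
  by rewrite expRN pow2_expR natrM; congr (expR _)^-1; ring.
have -> : expR (- (6 * ln 2 * kap%:R)) = ((2 ^ (4 * kap))%:R)^-1 * ((2 ^ (2 * kap))%:R)^-1 :> R.
  by rewrite -[6]/(6%:R) e2 -invfM -natrM -expnD -mulnDl.
apply: ler_pM; rewrite ?invr_ge0 ?ler0n //.
  case: (T i) (nT i) HSi => // p l _ H; have [pp lp] := H p (mem_head _ _).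
  rewrite /Hs'' big_cons -[leLHS]addr0; apply: lerD; last first.
    by apply: sumr_ge0 => q _; rewrite invr_ge0 exprn_ge0.
  have p0 : (0 < p)%N := prime_gt0 pp.
  rewrite lef_pV2 ?posrE ?exprn_gt0 ?ltr0n ?expn_gt0 // -natrX ler_nat.
  have -> : (4 * kap = (2 * kap) * 2)%N by lia.
  rewrite expnM leq_exp2r //; apply: ltnW (leq_trans (trunc_log_ltn p (isT : 1 < 2)%N) _).
  by rewrite leq_exp2l //; lia.
rewrite lef_pV2 ?posrE ?ltr0n ?expn_gt0 //; last by rewrite addr_gt0.
apply: le_trans (_ : 1 + 2 * kap%:R <= _); first by rewrite lerD2l.
by rewrite addrC -natrM natr1 ler_nat ltn_expl.
Qed.

End Assembly.

(* useOmega i = true : f_i(n) = Omega(n,T_i), Z_i ~ Pois(H'(T_i));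
   useOmega i = false : f_i(n) = omega(n,T_i), Z_i ~ Pois(H(T_i)). *)
Theorem theorem1 (R : realType) :
  exists C : R, forall (x y : R) (m : nat) (T : 'I_m -> seq nat)
    (useOmega : 'I_m -> bool),
    2 <= y -> y <= x ->
    (forall i, T i != [::]) ->
    (forall i, uniq (T i)) ->
    (forall i p, p \in T i -> prime p /\ p%:R <= y) ->
    (forall i j p, i != j -> p \in T i -> p \notin T j) ->
    let u := ln x / ln y in
    (dTV_unif_pois x
       (fun n => [ffun i => if useOmega i then OmegaT n (T i) else omegaT n (T i)])
       (fun i => if useOmega i then Hs' R (T i) else Hs R (T i))
     <= (C * (\sum_(j < m) Hs'' R (T j) / (1 + Hs R (T j)) + u `^ (- u)))%:E)%E.
Proof.
have [B B12 hB] := @rankin_exponent_le R.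
(* Three regimes: [C1] for bounded y, [C2] for bounded u, [C3] otherwise, where 84 = 80 + 2 + 2 with
   one 2 from [eta] and one from the power of y. *)
pose k0 : nat := (Num.truncn (expR B)).+1.
pose C1 : R := expR (6 * ln 2 * k0%:R).
pose C2 : R := expR (expR B * B).
pose C3 : R := 84 + 4 * expR 9.
have C10 : 0 < C1 by exact: expR_gt0.
have C20 : 0 < C2 by exact: expR_gt0.
have C30 : 0 < C3 by rewrite /C3; have := expR_gt0 (9 : R); lra.
exists (C1 + C2 + C3) => x y m T om y2 yx nT uT HTy dT.
cbv zeta; set u := ln x / ln y.
have HT i p : p \in T i -> prime p by move=> /HTy[].
have -> : (fun i => if om i then Hs' R (T i) else Hs R (T i)) =
          (fun i => set_lam R (om i) (T i)).
  by apply/funext => i; rewrite set_lamE.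
have y0 : 0 < y by lra.
have x0 : 0 < x by lra.
have lny : 0 < ln y by apply: ln_gt0; lra.
have u1 : 1 <= u by rewrite ler_pdivlMr // mul1r ler_ln ?posrE.
have up : u `^ (- u) = expR (- (u * ln u)) by rewrite /powR gt_eqF ?mulNr //; lra.
have up0 : 0 < u `^ (- u) by rewrite up expR_gt0.
have l0 i : 0 < set_lam R (om i) (T i) by apply: set_lam_gt0 => //; exact: HT.
have H1 j : 0 < Hs R (T j) by apply: Hs_gt0 => //; exact: HT.
set Sg := \sum_(j < m) _.
have Sg0 : 0 <= Sg.
  apply: sumr_ge0 => j _; rewrite divr_ge0 //; last by rewrite addr_ge0 // ltW.
  by apply: sumr_ge0 => p _; rewrite invr_ge0 exprn_ge0.
have bigC c : 0 <= c -> c <= C1 + C2 + C3 -> c * (Sg + u `^ (- u)) <= (C1 + C2 + C3) * (Sg + u `^ (- u)).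
  by move=> ? ?; rewrite ler_wpM2r // addr_ge0 // ltW.
(* Without sets the sum [Sg] is 0 and can absorb nothing, but both laws are the same point mass. *)
have [m0|m0] := posnP m.
  have N0 : (0 < Num.truncn x)%N by rewrite truncn_gt0; lra.
  have h := @dtv_le R m _ l0 x (fun n => [ffun i => if om i then OmegaT n (T i) else omegaT n (T i)])
    0 (fun=> 0) 0 0 N0 (fun=> lexx _).
  apply: le_trans (h _ _ _) _.
  - move=> k; suff -> : Px x (fun n => [ffun i => if om i then OmegaT n (T i) else omegaT n (T i)] = embed_box k) = 1.
      suff -> : pois_vec_pmf (fun i => set_lam R (om i) (T i)) (embed_box k) = 1 by rewrite subrr.
      by rewrite /pois_vec_pmf big1 // => i; have := ltn_ord i; rewrite {2}m0.
    rewrite PxE (eq_bigr (fun=> 1)).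
      by rewrite sumr_const card_ord divff // pnatr_eq0 -lt0n.
    move=> n _; suff -> : `[< [ffun i => if om i then OmegaT n.+1 (T i) else omegaT n.+1 (T i)] = embed_box k >] = true by [].
    by apply/asboolP/ffunP => i; have := ltn_ord i; rewrite {2}m0.
  - by rewrite big1.
  - by rewrite big1 ?subrr // => i; have := ltn_ord i; rewrite {2}m0.
  rewrite addr0 lee_fin mulr_ge0 ?addr_ge0 // ?(ltW up0) ?(ltW C10) ?(ltW C20) ?(ltW C30) //.
pose i0 : 'I_m := Ordinal m0.
pose Y := Num.truncn y.
have Y2 : (2 <= Y)%N by rewrite /Y truncn_ge_nat //; lra.
pose kap := lg Y.
have kap0 : (0 < kap)%N by rewrite /kap trunc_log_gt0.
have lk p : p \in unionT T (enum 'I_m) -> (lg p <= kap)%N.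
  case/flatten_mapP => i _ /HTy[_ py]; apply: leq_trunc_log.
  by rewrite /Y truncn_ge_nat //; lra.
have low := @Hs''_sum_lower R m T HT uT nT kap i0 lk kap0; rewrite -/Sg in low.
have x1 : 1 <= x by lra.
have le1 := @dtv_le1 R m T om HT nT x x1.
have [kk|kk] := ltnP kap k0.
  apply: le_trans le1 _; rewrite lee_fin.
  apply: le_trans (bigC C1 (ltW C10) _); last by lra.
  apply: le_trans (_ : C1 * Sg <= _); last by rewrite ler_wpM2l ?(ltW C10) // lerDl ltW.
  apply: le_trans (_ : C1 * expR (- (6 * ln 2 * kap%:R)) <= _); last by rewrite ler_wpM2l ?(ltW C10).
  have ln20 : 0 <= ln 2 :> R by apply: ln_ge0; lra.
  rewrite /C1 -expRD expR_ge1_ge0 // subr_ge0.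
  by apply: ler_wpM2l; [rewrite mulr_ge0|rewrite ler_nat ltnW].
have [uu|uu] := ltP u (expR B).
  apply: le_trans le1 _; rewrite lee_fin.
  apply: le_trans (bigC C2 (ltW C20) _); last by lra.
  apply: le_trans (_ : C2 * u `^ (- u) <= _); last by rewrite ler_wpM2l ?(ltW C20) // lerDr.
  rewrite up /C2 -expRD expR_ge1_ge0 // subr_ge0; apply: ler_pM.
  - lra.
  - exact: ln_ge0.
  - exact: ltW.
  - rewrite -[leRHS]expRK ler_ln ?posrE ?expR_gt0 ?(ltW uu) //; lra.
have kR : expR B <= kap%:R.
  apply: le_trans (_ : k0%:R <= _); last by rewrite ler_nat.
  exact/ltW/truncnS_gt.
have kR0 : 0 < kap%:R :> R by rewrite ltr0n.
have lnk : B <= ln kap%:R by rewrite -[leLHS]expRK ler_ln ?posrE ?expR_gt0.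
(* The cap at [kap] secures [16 * L <= kap]. *)
pose v := Num.min u kap%:R.
have vu : v <= u by rewrite /v ge_min lexx.
have vk : v <= kap%:R by rewrite /v ge_min lexx orbT.
have vB : expR B <= v by rewrite /v le_min uu.
have v0 : 0 < v by apply: lt_le_trans vB; exact: expR_gt0.
have lnv : B <= ln v by rewrite -[leLHS]expRK ler_ln ?posrE ?expR_gt0.
(* So e^(L - 1) = v, and the surplus e^(-v) in e^(-L v) pays for the other exponents. *)
pose L := 1 + ln v.
have L1 : B <= L by rewrite /L; lra.
have eL : expR (L - 1) = v by rewrite /L addrAC subrr add0r lnK ?posrE.
have Lk : 16 * L <= kap%:R.
  have : ln v <= ln kap%:R by rewrite ler_ln ?posrE.
  have [_] := hB _ lnk; rewrite lnK ?posrE // /L; lra.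
have sk : L / kap%:R * kap%:R = L by rewrite mulfVK // gt_eqF.
have L1' : 1 <= L by lra.
have ln2 : 1 / 2 <= ln 2 :> R by exact: ln2_ge_half.
have ux : expR (ln 2 * (v * kap%:R)) <= x.
  rewrite -[leRHS]lnK ?posrE // ler_expR.
  have -> : ln x = u * ln y by rewrite /u mulfVK // gt_eqF.
  have h1 : ln 2 * kap%:R <= ln y.
    rewrite -ler_expR lnK ?posrE // -pow2_expR; apply: le_trans (_ : Y%:R <= _).
      by rewrite ler_nat /kap trunc_logP //; apply: leq_trans Y2.
    by rewrite /Y truncn_le //; lra.
  rewrite mulrCA; apply: ler_pM => //; first exact: ltW.
  by rewrite mulr_ge0 //; lra.
have Sgp : 0 < Sg by apply: lt_le_trans low; exact: expR_gt0.
have main := @dtv_kubilius R m T om HT uT dT nT x v L (L / kap%:R) kap Sg lk L1' Lk sk x1 ux Sgp.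
apply: le_trans main _; rewrite lee_fin -/Sg.
have [hexp _] := hB _ L1; rewrite eL in hexp.
have hb : expR (- (L * v) + 77 * L + 9 + 5 * rankin_bound L + 64 * expR (L / 2)) <=
          expR 9 * expR (- (v * ln v)).
  by rewrite -expRD ler_expR; move: hexp; rewrite /L; lra.
have hv : expR (- (v * ln v)) <= Sg + u `^ (- u).
  rewrite /v; case: (leP u kap%:R) => h.
    by rewrite -up lerDr.
  apply: le_trans (_ : Sg <= _); last by rewrite lerDl ltW.
  apply: le_trans low; rewrite ler_expR lerN2 [leRHS]mulrC ler_wpM2r //.
  (* Hence 6 ln 2 < 12 <= B <= ln [kap]: this is why [B] was taken at least 12. *)
  have : ln 2 < 2 :> R by apply: ln_sublinear.
  lra.
have h10 : expR (- (10 * ln 2 * kap%:R)) <= Sg.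
  apply: le_trans low; rewrite ler_expR lerN2 ler_wpM2r //; lra.
have e9 := expR_gt0 (9 : R).
have hb2 : expR 9 * expR (- (v * ln v)) <= expR 9 * (Sg + u `^ (- u)).
  by rewrite ler_wpM2l // ltW.
apply: le_trans (bigC C3 (ltW C30) _); last by lra.
rewrite /C3.
have : 0 <= expR 9 * (Sg + u `^ (- u)) by rewrite mulr_ge0 ?addr_ge0 // ltW.
move: hb hb2 h10 up0; lra.
Qed.
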